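(* Let $K$ be a field, let $E$ and $F$ be row-finite graphs and let $\varphi:L_K(E)\to L_K(F)$ be a ring isomorphism (not necessarily graded). Then: (i) If $I$ is a graded ideal of $L_K(E)$, then $\varphi(I)$ is a graded ideal of $L_K(F)$. (ii) $|\mathcal H_E|=|\mathcal H_F|$.
   Context: A (directed) graph $E=(E^0,E^1,r,s)$ consists of sets $E^0$ (vertices), $E^1$ (edges) and maps $r,s:E^1\to E^0$ (range, source); it is row-finite if $s^{-1}(v)$ is finite for every $v\in E^0$. A sink is a vertex emitting no edges. A path is a vertex (length $0$) or a finite sequence of edges $e_1\cdots e_n$ with $r(e_i)=s(e_{i+1})$ (length $n$). The Leavitt path algebra $L_K(E)$ is the $K$-algebra generated by $E^0\cup E^1\cup\{e^*\mid e\in E^1\}$ with relations: $vw=\delta_{v,w}v$ for $v,w\in E^0$; $s(e)e=er(e)=e$ and $r(e)e^*=e^*s(e)=e^*$ for $e\in E^1$; $e^*f=\delta_{e,f}r(e)$ for $e,f\in E^1$; $v=\sum_{e\in s^{-1}(v)}ee^*$ for every $v\in E^0$ that is not a sink. It is $\mathbb Z$-graded, with degree $n$ component spanned by the elements $pq^*$ with $p,q$ paths, $l(p)-l(q)=n$, where $(e_1\cdots e_n)^*=e_n^*\cdots e_1^*$ and $v^*=v$. Graded ideals are with respect to this grading. Write $v\ge w$ if there is a path from $v$ to $w$. $H\subseteq E^0$ is hereditary if $v\in H$, $v\ge w$ imply $w\in H$; saturated if $s^{-1}(v)\ne\emptyset$ finite and $r(s^{-1}(v))\subseteq H$ imply $v\in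 H$. $\mathcal H_E$ denotes the set of hereditary saturated subsets of $E^0$. *)

(* Defs.v *)
From HB Require Import structures.
From mathcomp Require Import all_boot all_order all_algebra finmap generic_quotient.
From mathcomp Require Import mathcomp_extra boolp classical_sets functions.
From mathcomp Require Import cardinality.

Set Implicit Arguments.
Unset Strict Implicit.
Unset Printing Implicit Defensive.

Import GRing.Theory.
Local Open Scope classical_set_scope.
Local Open Scope ring_scope.
Local Open Scope quotient_scope.

(** A Leavitt path algebra has a unit only when its graph has finitely many
    vertices, so the unital rings of [ssralg] cannot be used. *)

HB.mixin Record Zmodule_isRng R of GRing.Zmodule R := {
  rmul : R -> R -> R;
  rmulA : associative rmul;
  rmulDl : left_distributive rmul +%R;
  rmulDr : right_distributive rmul +%R
}.

#[short(type="rngType")]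
HB.structure Definition Rng := { R of GRing.Zmodule R & Zmodule_isRng R }.

Declare Scope rng_scope.
Delimit Scope rng_scope with rng.
Infix "**" := rmul (at level 40, left associativity) : rng_scope.
Local Open Scope rng_scope.

HB.mixin Record Rng_isRngAlgebra (K : nzRingType) A
    of Rng A & GRing.Lmodule K A := {
  rscaleAl : forall (k : K) (x y : A), k *: (x ** y) = (k *: x) ** y;
  rscaleAr : forall (k : K) (x y : A), k *: (x ** y) = x ** (k *: y)
}.

#[short(type="rngAlgType")]
HB.structure Definition RngAlgebra (K : nzRingType) :=
  { A of Rng A & GRing.Lmodule K A & Rng_isRngAlgebra K A }.

(** Two-sided ideals of the ring; closure under scalars is not required. *)
Definition rng_ideal (R : rngType) (I : set R) : Prop :=
  [/\ I 0,
      forall x y, I x -> I y -> I (x - y),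
      forall a x, I x -> I (a ** x)
    & forall a x, I x -> I (x ** a)].

Definition rng_isomorphism (R S : rngType) (phi : R -> S) : Prop :=
  [/\ {morph phi : x y / x + y},
      {morph phi : x y / x ** y}
    & bijective phi].

Record graph := Graph {
  vertex : Type;
  edge : Type;
  rng : edge -> vertex;
  src : edge -> vertex
}.

(* Vertices and edges form arbitrary types, with classical equality and
   choice. *)
HB.instance Definition _ (E : graph) := gen_eqMixin (vertex E).
HB.instance Definition _ (E : graph) := gen_choiceMixin (vertex E).
HB.instance Definition _ (E : graph) := gen_eqMixin (edge E).
HB.instance Definition _ (E : graph) := gen_choiceMixin (edge E).

Definition emitted (E : graph) (v : vertex E) : set (edge E) :=
  [set e | src e = v].

Definition row_finite (E : graph) : Prop :=
  forall v : vertex E, finite_set (emitted v).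

Inductive gpath (E : graph) : Type :=
| Pvertex of vertex E
| Pedges (e : edge E) (es : seq (edge E))
    of path (fun f g => rng f == src g) e es.

Definition plength (E : graph) (p : gpath E) : nat :=
  match p with Pvertex _ => 0 | Pedges _ es _ => (size es).+1 end.

Definition psrc (E : graph) (p : gpath E) : vertex E :=
  match p with Pvertex v => v | Pedges e _ _ => src e end.

Definition prng (E : graph) (p : gpath E) : vertex E :=
  match p with Pvertex v => v | Pedges e es _ => rng (last e es) end.

Definition reaches (E : graph) (v w : vertex E) : Prop :=
  exists p : gpath E, psrc p = v /\ prng p = w.

Definition hereditary (E : graph) (H : set (vertex E)) : Prop :=
  forall v w, H v -> reaches v w -> H w.

Definition saturated (E : graph) (H : set (vertex E)) : Prop :=
  forall v, emitted v !=set0 -> finite_set (emitted v) ->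
    (@rng E) @` emitted v `<=` H -> H v.

Definition hereditary_saturated_sets (E : graph) : set (set (vertex E)) :=
  [set H | hereditary H /\ saturated H].

Arguments hereditary_saturated_sets : clear implicits.

(** [lpa K E] is the non-unital associative [K]-algebra presented by the
    generators [vtx v], [edg e], [gst e] (the latter standing for [e^*]) and the
    Leavitt relations: formal expressions modulo the least congruence containing
    the axioms of [K]-algebras and the relations. *)

Inductive lpa_term (K : fieldType) (E : graph) : Type :=
| Tvtx of vertex E
| Tedg of edge E
| Tgst of edge E
| Tzero
| Topp of lpa_term K E
| Tadd of lpa_term K E & lpa_term K E
| Tscale of K & lpa_term K E
| Tmul of lpa_term K E & lpa_term K E.

Arguments Tvtx K {E}.
Arguments Tedg K {E}.
Arguments Tgst K {E}.
Arguments Tzero {K E}.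

Inductive lpa_eq (K : fieldType) (E : graph) :
    lpa_term K E -> lpa_term K E -> Prop :=
| Erefl a : lpa_eq a a
| Esym a b : lpa_eq a b -> lpa_eq b a
| Etrans a b c : lpa_eq a b -> lpa_eq b c -> lpa_eq a c
| Eopp a b : lpa_eq a b -> lpa_eq (Topp a) (Topp b)
| Eadd a a' b b' : lpa_eq a a' -> lpa_eq b b' ->
    lpa_eq (Tadd a b) (Tadd a' b')
| Escale k a b : lpa_eq a b -> lpa_eq (Tscale k a) (Tscale k b)
| Emul a a' b b' : lpa_eq a a' -> lpa_eq b b' ->
    lpa_eq (Tmul a b) (Tmul a' b')
| EaddA a b c : lpa_eq (Tadd a (Tadd b c)) (Tadd (Tadd a b) c)
| EaddC a b : lpa_eq (Tadd a b) (Tadd b a)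
| Eadd0 a : lpa_eq (Tadd Tzero a) a
| EaddN a : lpa_eq (Tadd (Topp a) a) Tzero
| EscaleA k l a : lpa_eq (Tscale k (Tscale l a)) (Tscale (k * l) a)
| Escale1 a : lpa_eq (Tscale 1 a) a
| EscaleDr k a b : lpa_eq (Tscale k (Tadd a b)) (Tadd (Tscale k a) (Tscale k b))
| EscaleDl k l a : lpa_eq (Tscale (k + l) a) (Tadd (Tscale k a) (Tscale l a))
| EmulA a b c : lpa_eq (Tmul a (Tmul b c)) (Tmul (Tmul a b) c)
| EmulDl a b c : lpa_eq (Tmul (Tadd a b) c) (Tadd (Tmul a c) (Tmul b c))
| EmulDr a b c : lpa_eq (Tmul a (Tadd b c)) (Tadd (Tmul a b) (Tmul a c))
| EscaleAl k a b : lpa_eq (Tscale k (Tmul a b)) (Tmul (Tscale k a) b)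
| EscaleAr k a b : lpa_eq (Tscale k (Tmul a b)) (Tmul a (Tscale k b))
| Evv v : lpa_eq (Tmul (Tvtx K v) (Tvtx K v)) (Tvtx K v)
| Evw v w : v <> w -> lpa_eq (Tmul (Tvtx K v) (Tvtx K w)) Tzero
| Ese e : lpa_eq (Tmul (Tvtx K (src e)) (Tedg K e)) (Tedg K e)
| Eer e : lpa_eq (Tmul (Tedg K e) (Tvtx K (rng e))) (Tedg K e)
| Erg e : lpa_eq (Tmul (Tvtx K (rng e)) (Tgst K e)) (Tgst K e)
| Egs e : lpa_eq (Tmul (Tgst K e) (Tvtx K (src e))) (Tgst K e)
| Ege e : lpa_eq (Tmul (Tgst K e) (Tedg K e)) (Tvtx K (rng e))
| Egf e f : e <> f -> lpa_eq (Tmul (Tgst K e) (Tedg K f)) Tzero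
(* The finiteness guard is automatic for row-finite graphs; without it
   [fset_set] would return a junk value. *)
| Esum v : emitted v !=set0 -> finite_set (emitted v) ->
    lpa_eq (Tvtx K v)
      (foldr (@Tadd K E) Tzero
         [seq Tmul (Tedg K e) (Tgst K e) | e <- fset_set (emitted v)]).

Section LeavittPathAlgebra.
Variables (K : fieldType) (E : graph).

HB.instance Definition _ := gen_eqMixin (lpa_term K E).
HB.instance Definition _ := gen_choiceMixin (lpa_term K E).

Definition lpa_eqb : rel (lpa_term K E) := fun a b => `[< lpa_eq a b >].

Fact lpa_eqb_refl : reflexive lpa_eqb.
Proof. by move=> a; apply/asboolP; exact: Erefl. Qed.

Fact lpa_eqb_sym : symmetric lpa_eqb.
Proof. by move=> a b; apply/asboolP/asboolP; exact: Esym. Qed.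

Fact lpa_eqb_trans : transitive lpa_eqb.
Proof. by move=> b a c /asboolP ab /asboolP bc; apply/asboolP/(Etrans ab). Qed.

Canonical lpa_equiv := EquivRel lpa_eqb lpa_eqb_refl lpa_eqb_sym lpa_eqb_trans.

Definition lpa := {eq_quot lpa_equiv}.

HB.instance Definition _ := Choice.on lpa.
HB.instance Definition _ := Quotient.on lpa.

Definition lpa_class (a : lpa_term K E) : lpa := \pi_lpa a.

Lemma lpa_classP a b : lpa_class a = lpa_class b <-> lpa_eq a b.
Proof.
split=> [/eqquotP/asboolP//|ab].
by apply/eqquotP/asboolP.
Qed.

Lemma lpa_repr a : lpa_eq (repr (lpa_class a)) a.
Proof. by apply/lpa_classP; rewrite /lpa_class reprK. Qed.

Lemma lpa_ind (P : lpa -> Prop) :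
  (forall a, P (lpa_class a)) -> forall x, P x.
Proof. by move=> Pc x; rewrite -[x]reprK; exact: Pc. Qed.

Definition lpa_zero : lpa := lpa_class Tzero.
Definition lpa_opp (x : lpa) : lpa := lpa_class (Topp (repr x)).
Definition lpa_add (x y : lpa) : lpa := lpa_class (Tadd (repr x) (repr y)).
Definition lpa_scale (k : K) (x : lpa) : lpa := lpa_class (Tscale k (repr x)).
Definition lpa_mul (x y : lpa) : lpa := lpa_class (Tmul (repr x) (repr y)).

Lemma lpa_oppE a : lpa_opp (lpa_class a) = lpa_class (Topp a).
Proof. by apply/lpa_classP/Eopp/lpa_repr. Qed.

Lemma lpa_addE a b :
  lpa_add (lpa_class a) (lpa_class b) = lpa_class (Tadd a b).
Proof. by apply/lpa_classP/Eadd; apply: lpa_repr. Qed.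

Lemma lpa_scaleE k a : lpa_scale k (lpa_class a) = lpa_class (Tscale k a).
Proof. by apply/lpa_classP/Escale/lpa_repr. Qed.

Lemma lpa_mulE a b :
  lpa_mul (lpa_class a) (lpa_class b) = lpa_class (Tmul a b).
Proof. by apply/lpa_classP/Emul; apply: lpa_repr. Qed.

Let opE := (lpa_oppE, lpa_addE, lpa_scaleE, lpa_mulE).

Fact lpa_addA : associative lpa_add.
Proof.
elim/lpa_ind=> a; elim/lpa_ind=> b; elim/lpa_ind=> c.
by rewrite !opE; apply/lpa_classP/EaddA.
Qed.

Fact lpa_addC : commutative lpa_add.
Proof.
by elim/lpa_ind=> a; elim/lpa_ind=> b; rewrite !opE; apply/lpa_classP/EaddC.
Qed.

Fact lpa_add0 : left_id lpa_zero lpa_add.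
Proof. by elim/lpa_ind=> a; rewrite !opE; apply/lpa_classP/Eadd0. Qed.

Fact lpa_addN : left_inverse lpa_zero lpa_opp lpa_add.
Proof. by elim/lpa_ind=> a; rewrite !opE; apply/lpa_classP/EaddN. Qed.

HB.instance Definition _ :=
  GRing.isZmodule.Build lpa lpa_addA lpa_addC lpa_add0 lpa_addN.

Fact lpa_mulA : associative lpa_mul.
Proof.
elim/lpa_ind=> a; elim/lpa_ind=> b; elim/lpa_ind=> c.
by rewrite !opE; apply/lpa_classP/EmulA.
Qed.

Fact lpa_mulDl : left_distributive lpa_mul lpa_add.
Proof.
elim/lpa_ind=> a; elim/lpa_ind=> b; elim/lpa_ind=> c.
by rewrite !opE; apply/lpa_classP/EmulDl.
Qed.

Fact lpa_mulDr : right_distributive lpa_mul lpa_add.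
Proof.
elim/lpa_ind=> a; elim/lpa_ind=> b; elim/lpa_ind=> c.
by rewrite !opE; apply/lpa_classP/EmulDr.
Qed.

HB.instance Definition _ :=
  Zmodule_isRng.Build lpa lpa_mulA lpa_mulDl lpa_mulDr.

Fact lpa_scaleA k l x : lpa_scale k (lpa_scale l x) = lpa_scale (k * l) x.
Proof.
by elim/lpa_ind: x => a; rewrite !opE; apply/lpa_classP/EscaleA.
Qed.

Fact lpa_scale1 : left_id 1 lpa_scale.
Proof. by elim/lpa_ind=> a; rewrite !opE; apply/lpa_classP/Escale1. Qed.

Fact lpa_scaleDr : right_distributive lpa_scale lpa_add.
Proof.
move=> k; elim/lpa_ind=> a; elim/lpa_ind=> b.
by rewrite !opE; apply/lpa_classP/EscaleDr.
Qed.

Fact lpa_scaleDl x : {morph lpa_scale^~ x : k l / k + l >-> lpa_add k l}.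
Proof.
by move=> k l; elim/lpa_ind: x => a; rewrite !opE; apply/lpa_classP/EscaleDl.
Qed.

HB.instance Definition _ := GRing.Zmodule_isLmodule.Build K lpa
  lpa_scaleA lpa_scale1 lpa_scaleDr lpa_scaleDl.

Fact lpa_scaleAl k x y :
  lpa_scale k (lpa_mul x y) = lpa_mul (lpa_scale k x) y.
Proof.
elim/lpa_ind: x => a; elim/lpa_ind: y => b.
by rewrite !opE; apply/lpa_classP/EscaleAl.
Qed.

Fact lpa_scaleAr k x y :
  lpa_scale k (lpa_mul x y) = lpa_mul x (lpa_scale k y).
Proof.
elim/lpa_ind: x => a; elim/lpa_ind: y => b.
by rewrite !opE; apply/lpa_classP/EscaleAr.
Qed.

HB.instance Definition _ :=
  Rng_isRngAlgebra.Build K lpa lpa_scaleAl lpa_scaleAr.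

Definition vtx (v : vertex E) : lpa := lpa_class (Tvtx K v).
Definition edg (e : edge E) : lpa := lpa_class (Tedg K e).
Definition gst (e : edge E) : lpa := lpa_class (Tgst K e).

Definition lpa_path (p : gpath E) : lpa :=
  match p with
  | Pvertex v => vtx v
  | Pedges e es _ => foldl (fun x f => x ** edg f) (edg e) es
  end.

Definition lpa_path_star (p : gpath E) : lpa :=
  match p with
  | Pvertex v => vtx v
  | Pedges e es _ => foldl (fun x f => gst f ** x) (gst e) es
  end.

Definition lpa_homogeneous (n : int) : set lpa :=
  [set x | exists (m : nat) (c : 'I_m -> K) (p q : 'I_m -> gpath E),
     (forall i, (plength (p i))%:Z - (plength (q i))%:Z = n) /\
     x = \sum_(i < m) c i *: (lpa_path (p i) ** lpa_path_star (q i))].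

(** [I] is the sum of its intersections with the homogeneous components. *)
Definition graded_ideal (I : set lpa) : Prop :=
  rng_ideal I /\
  forall x, I x -> exists (s : seq int) (y : int -> lpa),
    [/\ uniq s,
        forall n, n \in s -> I (y n) /\ lpa_homogeneous n (y n)
      & x = \sum_(n <- s) y n].

End LeavittPathAlgebra.

Section Universal.
Variables (K : fieldType) (E : graph) (A : rngAlgType K).
Variables (a : vertex E -> A) (b c : edge E -> A).

Fixpoint lpa_eval (t : lpa_term K E) : A :=
  match t with
  | Tvtx v => a v
  | Tedg e => b e
  | Tgst e => c e
  | Tzero => 0
  | Topp t => - lpa_eval t
  | Tadd t u => lpa_eval t + lpa_eval u
  | Tscale k t => k *: lpa_eval t
  | Tmul t u => lpa_eval t ** lpa_eval u
  end.

Lemma lpa_universal :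
  (forall v w, a v ** a w = if v == w then a v else 0) ->
  (forall e, a (src e) ** b e = b e /\ b e ** a (rng e) = b e) ->
  (forall e, a (rng e) ** c e = c e /\ c e ** a (src e) = c e) ->
  (forall e f, c e ** b f = if e == f then a (rng e) else 0) ->
  (forall v, emitted v !=set0 -> finite_set (emitted v) ->
     a v = \sum_(e <- fset_set (emitted v)) b e ** c e) ->
  exists! phi : lpa K E -> A,
    [/\ {morph phi : x y / x + y},
        {morph phi : x y / x ** y},
        forall k, {morph phi : x / k *: x}
      & [/\ forall v, phi (vtx K v) = a v,
            forall e, phi (edg K e) = b e
          & forall e, phi (gst K e) = c e]].
Proof.
move=> aa ab ac cb asum.
have evalP t u : lpa_eq t u -> lpa_eval t = lpa_eval u.
  elim=> //=.
  - by move=> ? ? ? _ -> _ ->.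
  - by move=> ? ? _ ->.
  - by move=> ? ? ? ? _ -> _ ->.
  - by move=> ? ? ? _ ->.
  - by move=> ? ? ? ? _ -> _ ->.
  - by move=> ? ? ?; rewrite addrA.
  - by move=> ? ?; rewrite addrC.
  - by move=> ?; rewrite add0r.
  - by move=> ?; rewrite addNr.
  - by move=> ? ? ?; rewrite scalerA.
  - by move=> ?; rewrite scale1r.
  - by move=> ? ? ?; rewrite scalerDr.
  - by move=> ? ? ?; rewrite scalerDl.
  - by move=> ? ? ?; rewrite rmulA.
  - by move=> ? ? ?; rewrite rmulDl.
  - by move=> ? ? ?; rewrite rmulDr.
  - by move=> ? ? ?; rewrite rscaleAl.
  - by move=> ? ? ?; rewrite rscaleAr.
  - by move=> v; rewrite aa eqxx.
  - by move=> v w /eqP/negPf vw; rewrite aa vw.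
  - by move=> e; case: (ab e).
  - by move=> e; case: (ab e).
  - by move=> e; case: (ac e).
  - by move=> e; case: (ac e).
  - by move=> e; rewrite cb eqxx.
  - by move=> e f /eqP/negPf ef; rewrite cb ef.
  move=> v v0 vfin; rewrite asum //.
  by elim: (enum_fset _) => [|e s IHs]; rewrite ?big_nil ?big_cons //= IHs.
have phiE t : lpa_eval (repr (lpa_class t)) = lpa_eval t.
  by apply: evalP; exact: lpa_repr.
exists (fun x => lpa_eval (repr x)); split.
  split=> [x y|x y|k x|].
  - exact: (phiE (Tadd (repr x) (repr y))).
  - exact: (phiE (Tmul (repr x) (repr y))).
  - exact: (phiE (Tscale k (repr x))).
  - by split=> ?; exact: phiE.
move=> psi [psiD psiM psiZ [psiv psie psig]].
have psi0 : psi 0 = 0 by rewrite -(scale0r (0 : lpa K E)) psiZ scale0r.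
have psiN x : psi (- x) = - psi x by rewrite -scaleN1r psiZ scaleN1r.
apply/funext; elim/lpa_ind => t; rewrite phiE.
elim: t => [v|e|e||t IHt|t IHt u IHu|k t IHt|t IHt u IHu] /=;
  do ?by rewrite ?psiv ?psie ?psig ?psi0.
- by rewrite IHt -psiN -lpa_oppE.
- by rewrite IHt IHu -psiD -lpa_addE.
- by rewrite IHt -psiZ -lpa_scaleE.
- by rewrite IHt IHu -psiM -lpa_mulE.
Qed.

End Universal.

(* Main.v *)
From HB Require Import structures.
From mathcomp Require Import all_boot all_algebra finmap.
From mathcomp Require Import boolp classical_sets functions.
From mathcomp Require Import cardinality.
Require Import Defs.

(** A graded ideal is the same thing as an idempotent ideal, and idempotency is
    preserved by every ring isomorphism.

    Idempotent implies graded in any Z-graded ring [L]: multiplying the component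
    of degree [n] by [(1 + s)^n] defines a ring morphism [alpha : L -> L[[s]]]
    congruent to the identity modulo [s], so [alpha] maps [I = I^(k+1)] into
    [I[[s]] + s^(k+1) L[[s]]] for all [k], hence into [I[[s]]].  If [x] in [I] has
    components [x_d], this gives [sum_d 'C(d, k) x_d] in [I] for all [k] (up to a
    shift of the degrees), a unitriangular system that puts every [x_d] in [I].

    Conversely, expanding vertices by the relation [v = sum e e^*] shows that a
    graded ideal is generated by the vertices it contains, which are
    idempotents.  These vertices form a hereditary saturated set, and every such
    set [H] arises: [L(E)] has a representation in which exactly the vertices of
    [H] vanish. *)

Set Implicit Arguments.
Unset Strict Implicit.
Unset Printing Implicit Defensive.
Import GRing.Theory.
Local Open Scope classical_set_scope.
Local Open Scope ring_scope.
Local Open Scope rng_scope.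
Local Open Scope card_scope.

(** * The algebra of linear endomorphisms *)

Lemma linear_map0 (K : pzRingType) (U V : lmodType K) (f : U -> V) :
  linear f -> f 0 = 0.
Proof.
by move=> lf; have := lf (-1) 0 0; rewrite scaler0 addr0 scaleN1r addNr.
Qed.

Section LinearEndomorphisms.
Variables (K : comNzRingType) (V : lmodType K).

Definition linear_endo : {pred V -> V} := fun f => `[< linear f >].

Fact linear_endo_closed : submod_closed linear_endo.
Proof.
split=> [|k f g /asboolP lf /asboolP lg]; apply/asboolP => l u v.
  by rewrite /= scaler0 addr0.
rewrite !fctE lf lg !scalerDr !scalerA mulrC -!addrA; congr (_ + _).
by rewrite addrCA.
Qed.

HB.instance Definition _ :=
  GRing.isSubmodClosed.Build K (V -> V) linear_endo linear_endo_closed.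

(** Bundled as a subtype so as to inherit its module structure from [V -> V]; with composition it
    becomes a target algebra for [lpa_universal]. *)
Record lin_endo := LinEndo { endo_fun :> V -> V; _ : endo_fun \in linear_endo }.

HB.instance Definition _ := [isSub for endo_fun].
HB.instance Definition _ := [Choice of lin_endo by <:].
HB.instance Definition _ := [SubChoice_isSubLmodule of lin_endo by <:].

Lemma endo_linear (f : lin_endo) : linear f.
Proof. by case: f => f /= /asboolP. Qed.

Lemma endo_eqP (f g : lin_endo) : (forall v, f v = g v) -> f = g.
Proof. by move=> fg; apply/val_inj/funext. Qed.

Fact endo_comp_subproof (f g : lin_endo) : f \o g \in linear_endo.
Proof. by apply/asboolP => k u v /=; rewrite !endo_linear. Qed.

Definition endo_comp (f g : lin_endo) := LinEndo (endo_comp_subproof f g).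

Fact endo_compA : associative endo_comp.
Proof. by move=> f g h; apply: endo_eqP. Qed.

Fact endo_compDl : left_distributive endo_comp +%R.
Proof. by move=> f g h; apply: endo_eqP. Qed.

Fact endo_compDr : right_distributive endo_comp +%R.
Proof.
move=> f g h; apply: endo_eqP => v /=; rewrite !fctE /=.
by have /= := endo_linear f 1 (g v) (h v); rewrite !scale1r.
Qed.

HB.instance Definition _ :=
  Zmodule_isRng.Build lin_endo endo_compA endo_compDl endo_compDr.

Fact endo_scaleAl k (f g : lin_endo) : k *: (f ** g) = (k *: f) ** g.
Proof. exact: endo_eqP. Qed.

Fact endo_scaleAr k (f g : lin_endo) : k *: (f ** g) = f ** (k *: g).
Proof.
apply: endo_eqP => v /=; rewrite !fctE /=.
by have := endo_linear f k (g v) 0; rewrite (linear_map0 (endo_linear f)) !addr0.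
Qed.

HB.instance Definition _ :=
  Rng_isRngAlgebra.Build K lin_endo endo_scaleAl endo_scaleAr.

End LinearEndomorphisms.

(** * Representations and ideals of non-unital rings *)

Section Representation.
Variables (K : fieldType) (E : graph) (V : lmodType K).
Variables (a : vertex E -> V -> V) (b c : edge E -> V -> V).

Record is_lpa_rep (rho : lpa K E -> V -> V) : Prop := IsLpaRep {
  repD : forall x y f, rho (x + y) f = rho x f + rho y f;
  repM : forall x y f, rho (x ** y) f = rho x (rho y f);
  repZ : forall k x f, rho (k *: x) f = k *: rho x f;
  rep_linear : forall x, linear (rho x);
  rep_vtx : forall v, rho (vtx K v) =1 a v;
  rep_edg : forall e, rho (edg K e) =1 b e;
  rep_gst : forall e, rho (gst K e) =1 c e
}.

(** The hypotheses are the Leavitt relations read pointwise; the universal property, applied to the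
    algebra [lin_endo V], supplies the action. *)
Lemma lpa_rep_exists :
  (forall v, linear (a v)) -> (forall e, linear (b e)) ->
  (forall e, linear (c e)) ->
  (forall v w f, a v (a w f) = if v == w then a v f else 0) ->
  (forall e f, a (src e) (b e f) = b e f) ->
  (forall e f, b e (a (rng e) f) = b e f) ->
  (forall e f, a (rng e) (c e f) = c e f) ->
  (forall e f, c e (a (src e) f) = c e f) ->
  (forall e e' f, c e (b e' f) = if e == e' then a (rng e) f else 0) ->
  (forall v f, emitted v !=set0 -> finite_set (emitted v) ->
     a v f = \sum_(e <- fset_set (emitted v)) b e (c e f)) ->
  exists rho, is_lpa_rep rho.
Proof.
move=> la lb lc aa ab ba ac ca cb asum.
pose A v : lin_endo V := LinEndo (asboolT (la v)).
pose B e : lin_endo V := LinEndo (asboolT (lb e)).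
pose C e : lin_endo V := LinEndo (asboolT (lc e)).
have [|e|e|e f|v v0 vfin|] := @lpa_universal K E (lin_endo V) A B C.
- by move=> v w; apply: endo_eqP => f /=; rewrite aa; case: eqP.
- by split; apply: endo_eqP => f /=; rewrite (ab, ba).
- by split; apply: endo_eqP => f /=; rewrite (ac, ca).
- by apply: endo_eqP => g /=; rewrite cb; case: eqP.
- apply: endo_eqP => g /=; rewrite asum //.
  by elim/big_rec2: _ => // e y x _ ->.
move=> phi [[phiD phiM phiZ [phiv phie phig]] _].
exists (fun x => endo_fun (phi x)); split=> [x y f|x y f|k x f|x|v f|e f|e f].
- by rewrite phiD.
- by rewrite phiM.
- by rewrite phiZ.
- exact: endo_linear.
- by rewrite phiv.
- by rewrite phie.
- by rewrite phig.
Qed.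

End Representation.

Section RngTheory.
Variable R : rngType.
Implicit Types (x y : R) (I : set R).

Lemma rmul0r x : 0 ** x = 0.
Proof. by apply: (addrI (0 ** x)); rewrite -rmulDl !addr0. Qed.

Lemma rmulr0 x : x ** 0 = 0.
Proof. by apply: (addrI (x ** 0)); rewrite -rmulDr !addr0. Qed.

Lemma rmulrN x y : x ** (- y) = - (x ** y).
Proof. by apply/eqP; rewrite -addr_eq0 -rmulDr addNr rmulr0. Qed.

Lemma rmulNr x y : (- x) ** y = - (x ** y).
Proof. by apply/eqP; rewrite -addr_eq0 -rmulDl addNr rmul0r. Qed.

Lemma rmulrB x y z : x ** (y - z) = x ** y - x ** z.
Proof. by rewrite rmulDr rmulrN. Qed.

Lemma rmul_suml (T : Type) (s : seq T) (F : T -> R) x :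
  (\sum_(i <- s) F i) ** x = \sum_(i <- s) F i ** x.
Proof.
by elim: s => [|i s IHs]; rewrite ?big_nil ?rmul0r // !big_cons rmulDl IHs.
Qed.

Lemma rmul_sumr (T : Type) (s : seq T) (F : T -> R) x :
  x ** (\sum_(i <- s) F i) = \sum_(i <- s) x ** F i.
Proof.
by elim: s => [|i s IHs]; rewrite ?big_nil ?rmulr0 // !big_cons rmulDr IHs.
Qed.

Definition additive_subgroup I : Prop :=
  I 0 /\ forall x y, I x -> I y -> I (x - y).

Section AdditiveSubgroup.
Variable I : set R.
Hypothesis subI : additive_subgroup I.

Lemma subgroup0 : I 0. Proof. by case: subI. Qed.

Lemma subgroupB x y : I x -> I y -> I (x - y).
Proof. by case: subI => _; apply. Qed.

Lemma subgroupN x : I x -> I (- x).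
Proof. by rewrite -sub0r; apply: subgroupB; exact: subgroup0. Qed.

Lemma subgroupD x y : I x -> I y -> I (x + y).
Proof. by move=> Ix Iy; rewrite -[y]opprK; apply/subgroupB/subgroupN. Qed.

Lemma subgroupMn x n : I x -> I (x *+ n).
Proof.
by move=> Ix; elim: n => [|n IHn]; rewrite ?mulrS; [exact: subgroup0|exact: subgroupD].
Qed.

Lemma subgroup_sum (T : Type) (s : seq T) (P : pred T) (F : T -> R) :
  (forall i, P i -> I (F i)) -> I (\sum_(i <- s | P i) F i).
Proof. by move=> IF; elim/big_ind: _; [exact: subgroup0|exact: subgroupD|]. Qed.

Lemma subgroup_sum_seq (T : eqType) (s : seq T) (F : T -> R) :
  (forall i, i \in s -> I (F i)) -> I (\sum_(i <- s) F i).
Proof. by move=> IF; rewrite big_seq; exact: subgroup_sum. Qed.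

End AdditiveSubgroup.

Lemma rng_ideal_subgroup I : rng_ideal I -> additive_subgroup I.
Proof. by case. Qed.

Lemma rng_idealMl I x y : rng_ideal I -> I y -> I (x ** y).
Proof. by case=> _ _ + _; apply. Qed.

Lemma rng_idealMr I x y : rng_ideal I -> I x -> I (x ** y).
Proof. by case=> _ _ _; apply. Qed.

Definition generated_ideal (S : set R) : set R :=
  [set x | forall J, rng_ideal J -> S `<=` J -> J x].

Lemma generated_ideal_ideal S : rng_ideal (generated_ideal S).
Proof.
split=> [J []//|x y Sx Sy J JI SJ|a x Sx J JI SJ|a x Sx J JI SJ].
- by apply: (subgroupB (rng_ideal_subgroup JI)); [exact: Sx|exact: Sy].
- by apply: rng_idealMl => //; exact: Sx.
- by apply: rng_idealMr => //; exact: Sx.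
Qed.

Lemma sub_generated_ideal S : S `<=` generated_ideal S.
Proof. by move=> x Sx J _; apply. Qed.

Lemma generated_ideal_min (S J : set R) :
  rng_ideal J -> S `<=` J -> generated_ideal S `<=` J.
Proof. by move=> JI SJ x; apply. Qed.

(** [I = I * I], the product being the additive subgroup generated by the
    pairwise products. *)
Definition idempotent_ideal I : Prop :=
  rng_ideal I /\ forall J, additive_subgroup J ->
    (forall x y, I x -> I y -> J (x ** y)) -> I `<=` J.

(** The additive span [Q] of the products of two elements of the ideal is again an ideal, and it
    contains each generator [x = x ** x], hence the whole ideal. *)
Lemma generated_by_idempotents S :
  (forall x, S x -> x ** x = x) -> idempotent_ideal (generated_ideal S).
Proof.
move=> Sid; have gI := generated_ideal_ideal S; split=> // J subJ prodJ.
pose Q := [set x | forall J, additive_subgroup J ->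
  (forall y z, generated_ideal S y -> generated_ideal S z -> J (y ** z)) -> J x].
suff QI : rng_ideal Q.
  move=> x /(generated_ideal_min QI); apply=> // y Sy J' _.
  by rewrite -(Sid y Sy); apply; exact: sub_generated_ideal.
split=> [J' []//|x y Qx Qy J' sJ pJ|a x Qx J' sJ pJ|a x Qx J' sJ pJ].
- by apply: (subgroupB sJ); [exact: Qx|exact: Qy].
(* Pulling [J'] back along multiplication by [a] gives a subgroup that still contains all the
   products, by associativity. *)
- apply: (Qx [set y | J' (a ** y)]); first split; rewrite /= ?rmulr0.
  + exact: (subgroup0 sJ).
  + by move=> ? ?; rewrite rmulrB; exact: (subgroupB sJ).
  + by move=> y z Sy Sz; rewrite /= rmulA; apply: pJ => //; exact: (rng_idealMl _ gI).
- apply: (Qx [set y | J' (y ** a)]); first split; rewrite /= ?rmul0r.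
  + exact: (subgroup0 sJ).
  + by move=> ? ?; rewrite rmulDl rmulNr; exact: (subgroupB sJ).
  + by move=> y z Sy Sz; rewrite /= -rmulA; apply: pJ => //; exact: (rng_idealMr _ gI).
Qed.

End RngTheory.

Section Isomorphism.
Variables (R S : rngType) (phi : R -> S).
Hypothesis phi_iso : rng_isomorphism phi.

Lemma rng_iso0 : phi 0 = 0.
Proof.
by case: phi_iso => phiD _ _; apply: (addrI (phi 0)); rewrite -phiD !addr0.
Qed.

Lemma rng_isoN x : phi (- x) = - phi x.
Proof.
case: phi_iso => phiD _ _.
by apply/eqP; rewrite -addr_eq0 -phiD addNr rng_iso0.
Qed.

Lemma rng_iso_inv psi : cancel phi psi -> cancel psi phi -> rng_isomorphism psi.
Proof.
case: phi_iso => phiD phiM _ phiK psiK.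
split=> [x y|x y|]; last by exists phi.
  by rewrite -{1}(psiK x) -{1}(psiK y) -phiD phiK.
by rewrite -{1}(psiK x) -{1}(psiK y) -phiM phiK.
Qed.

(** Test subgroups are pulled back along [phi], and multipliers in [S] are images of multipliers in
    [R]. *)
Lemma idempotent_ideal_image I :
  idempotent_ideal I -> idempotent_ideal (phi @` I).
Proof.
case: phi_iso => phiD phiM [psi phiK psiK] [II Isq].
split; first split.
- by exists 0; [exact: subgroup0 (rng_ideal_subgroup II)|exact: rng_iso0].
- move=> _ _ [x Ix <-] [y Iy <-]; exists (x - y); last by rewrite phiD rng_isoN.
  exact: (subgroupB (rng_ideal_subgroup II)).
- move=> a _ [x Ix <-]; exists (psi a ** x); last by rewrite phiM psiK.
  exact: rng_idealMl.
- move=> a _ [x Ix <-]; exists (x ** psi a); last by rewrite phiM psiK.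
  exact: rng_idealMr.
move=> J subJ prodJ _ [z Iz <-].
apply: (Isq [set x | J (phi x)]) Iz => [|x y Ix Iy].
  split=> [|x y Jx Jy] /=; first by rewrite rng_iso0; exact: (subgroup0 subJ).
  by rewrite phiD rng_isoN; exact: (subgroupB subJ).
by rewrite /= phiM; apply: prodJ; [exists x|exists y].
Qed.

End Isomorphism.

(** * Monomials in a Leavitt path algebra *)

Section LeavittBasics.
Variables (K : fieldType) (E : graph).
Local Notation L := (lpa K E).
Implicit Types (x y z : L) (e f : edge E) (v w u : vertex E).
Implicit Types (p q : seq (edge E)) (s t : seq (vertex E)).

Lemma lpa_gen_ind (P : L -> Prop) :
  (forall v, P (vtx K v)) -> (forall e, P (edg K e)) ->
  (forall e, P (gst K e)) -> P 0 -> (forall x, P x -> P (- x)) ->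
  (forall x y, P x -> P y -> P (x + y)) ->
  (forall k x, P x -> P (k *: x)) ->
  (forall x y, P x -> P y -> P (x ** y)) -> forall x, P x.
Proof.
move=> Pv Pe Pg P0 PN PD PZ PM; apply: lpa_ind.
elim=> // [t /PN|t Pt t' /(PD _ _ Pt)|k t /(PZ k)|t Pt t' /(PM _ _ Pt)].
- by rewrite -lpa_oppE.
- by rewrite -lpa_addE.
- by rewrite -lpa_scaleE.
- by rewrite -lpa_mulE.
Qed.

Lemma vtxM v w : vtx K v ** vtx K w = if v == w then vtx K v else 0.
Proof.
case: eqP => [<-|/(Evw K)/lpa_classP vw]; rewrite -[_ ** _]/(lpa_mul _ _) lpa_mulE //.
exact/lpa_classP/Evv.
Qed.

Lemma src_edg e : vtx K (src e) ** edg K e = edg K e.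
Proof. by rewrite -[_ ** _]/(lpa_mul _ _) lpa_mulE; exact/lpa_classP/Ese. Qed.

Lemma edg_rng e : edg K e ** vtx K (rng e) = edg K e.
Proof. by rewrite -[_ ** _]/(lpa_mul _ _) lpa_mulE; exact/lpa_classP/Eer. Qed.

Lemma rng_gst e : vtx K (rng e) ** gst K e = gst K e.
Proof. by rewrite -[_ ** _]/(lpa_mul _ _) lpa_mulE; exact/lpa_classP/Erg. Qed.

Lemma gst_src e : gst K e ** vtx K (src e) = gst K e.
Proof. by rewrite -[_ ** _]/(lpa_mul _ _) lpa_mulE; exact/lpa_classP/Egs. Qed.

Lemma gst_edg e f : gst K e ** edg K f = if e == f then vtx K (rng e) else 0.
Proof.
case: eqP => [<-|/(Egf K)/lpa_classP ef]; rewrite -[_ ** _]/(lpa_mul _ _) lpa_mulE //.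
exact/lpa_classP/Ege.
Qed.

Lemma vtx_sum v : emitted v !=set0 -> finite_set (emitted v) ->
  vtx K v = \sum_(e <- fset_set (emitted v)) edg K e ** gst K e.
Proof.
move=> v0 vfin; apply: etrans (proj2 (lpa_classP _ _) (Esum K v0 vfin)) _.
elim: (enum_fset _) => [|e s IHs]; rewrite ?big_nil ?big_cons //=.
by rewrite -lpa_addE -lpa_mulE IHs.
Qed.

Lemma vtx_edg v e : vtx K v ** edg K e = if v == src e then edg K e else 0.
Proof.
by rewrite -{1}src_edg rmulA vtxM; case: eqP => [->|_]; rewrite ?rmul0r ?src_edg.
Qed.

Lemma vtx_gst v e : vtx K v ** gst K e = if v == rng e then gst K e else 0.
Proof.
by rewrite -{1}rng_gst rmulA vtxM; case: eqP => [->|_]; rewrite ?rmul0r ?rng_gst.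
Qed.

Lemma edg_vtx e v : edg K e ** vtx K v = if rng e == v then edg K e else 0.
Proof.
by rewrite -{1}edg_rng -rmulA vtxM; case: eqP; rewrite ?rmulr0 ?edg_rng.
Qed.

Lemma gst_vtx e v : gst K e ** vtx K v = if src e == v then gst K e else 0.
Proof.
by rewrite -{1}gst_src -rmulA vtxM; case: eqP; rewrite ?rmulr0 ?gst_src.
Qed.

(** [undup] keeps this a sum of distinct orthogonal idempotents, so that lists may be concatenated
    freely. *)
Definition vtx_sum_of (s : seq (vertex E)) : L := \sum_(v <- undup s) vtx K v.

Lemma vtx_sum_of_l s v : v \in s -> vtx_sum_of s ** vtx K v = vtx K v.
Proof.
rewrite -mem_undup => vs; rewrite /vtx_sum_of rmul_suml (bigD1_seq v) ?undup_uniq //=.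
by rewrite vtxM eqxx big1 ?addr0 // => w /negPf wv; rewrite vtxM wv.
Qed.

Lemma vtx_sum_of_r s v : v \in s -> vtx K v ** vtx_sum_of s = vtx K v.
Proof.
rewrite -mem_undup => vs; rewrite /vtx_sum_of rmul_sumr (bigD1_seq v) ?undup_uniq //=.
by rewrite vtxM eqxx big1 ?addr0 // => w /negPf wv; rewrite vtxM eq_sym wv.
Qed.

(** Quantifying over every list [s'] containing [s] lets the lists found for two elements be merged
    by concatenation. *)
Lemma local_units x : exists s, forall s' : seq (vertex E), {subset s <= s'} ->
  vtx_sum_of s' ** x = x /\ x ** vtx_sum_of s' = x.
Proof.
have unitM y s' v w : v \in s' -> w \in s' -> vtx K v ** y = y ->
    y ** vtx K w = y -> vtx_sum_of s' ** y = y /\ y ** vtx_sum_of s' = y.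
  move=> vs ws vy yw; split.
    by rewrite -vy rmulA vtx_sum_of_l.
  by rewrite -yw -rmulA vtx_sum_of_r.
elim/lpa_gen_ind: x => [v|e|e||x [s us]|x y [s us] [t ut]|k x [s us]|x y [s us] [t ut]].
- exists [:: v] => s' ss'; apply: (unitM _ _ v v); rewrite ?vtxM ?eqxx //;
    by rewrite ss' ?inE ?eqxx.
- exists [:: src e; rng e] => s' ss'.
  by apply: (unitM _ _ (src e) (rng e)); rewrite ?src_edg ?edg_rng //;
    rewrite ss' ?inE ?eqxx ?orbT.
- exists [:: src e; rng e] => s' ss'.
  by apply: (unitM _ _ (rng e) (src e)); rewrite ?gst_src ?rng_gst //;
    rewrite ss' ?inE ?eqxx ?orbT.
- by exists [::] => s' _; rewrite rmulr0 rmul0r.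
- by exists s => s' /us[]; rewrite rmulrN rmulNr => -> ->.
- exists (s ++ t) => s' ss'; rewrite rmulDr rmulDl.
  have [|-> ->] := us s'; first by move=> v vs; rewrite ss' ?mem_cat ?vs.
  by have [|-> ->] := ut s' => // v vs; rewrite ss' ?mem_cat ?vs ?orbT.
- by exists s => s' /us[]; rewrite -rscaleAr -rscaleAl => -> ->.
- exists (s ++ t) => s' ss'; rewrite rmulA -[_ ** _ ** vtx_sum_of _]rmulA.
  have [|-> _] := us s'; first by move=> v vs; rewrite ss' ?mem_cat ?vs.
  by have [|_ ->] := ut s' => // v vs; rewrite ss' ?mem_cat ?vs ?orbT.
Qed.

Lemma left_unit x : exists s, x = \sum_(v <- s) vtx K v ** x.
Proof.
by have [s /(_ s)[//|xs _]] := local_units x; exists (undup s); rewrite -rmul_suml.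
Qed.

Lemma right_unit x : exists s, x = \sum_(v <- s) x ** vtx K v.
Proof.
by have [s /(_ s)[//|_ xs]] := local_units x; exists (undup s); rewrite -rmul_sumr.
Qed.

(** Provides the constant power series to which the twisted action is applied when components are
    read off in [idempotent_ideal_components]. *)
Lemma common_right_unit (n : nat) (y : nat -> L) :
  exists z, forall i, (i < n)%N -> y i ** z = y i.
Proof.
suff [s us] : exists s, forall s' : seq (vertex E), {subset s <= s'} ->
    forall i, (i < n)%N -> y i ** vtx_sum_of s' = y i.
  by exists (vtx_sum_of s) => i; exact: us.
elim: n => [|n [s us]]; first by exists [::].
have [t ut] := local_units (y n); exists (s ++ t) => s' ss' i; rewrite ltnS leq_eqVlt.
case/orP=> [/eqP->|]; last by apply: us => v vs; rewrite ss' ?mem_cat ?vs.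
by have [|//] := ut s'; move=> v vs; rewrite ss' ?mem_cat ?vs ?orbT.
Qed.

(* [p v q^*]; the lists [p] and [q] need not be paths ending at [v], and then the
   product vanishes. *)
Definition mono p v q : L :=
  foldr (fun e x => edg K e ** x) (foldr (fun f x => x ** gst K f) (vtx K v) q) p.

Lemma mono_consl e p v q : mono (e :: p) v q = edg K e ** mono p v q.
Proof. by []. Qed.

Lemma mono_consr p v e q : mono p v (e :: q) = mono p v q ** gst K e.
Proof. by elim: p => // f p IHp; rewrite !mono_consl IHp rmulA. Qed.

(** Here and in the next lemmas, multiplying a monomial by a generator gives a monomial of
    controlled lengths or zero; the degree arguments need no more. *)
Lemma vtx_mono u p v q :
  vtx K u ** mono p v q = mono p v q \/ vtx K u ** mono p v q = 0.
Proof.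
case: p => [|e p].
  elim: q => [|f q IHq]; last first.
    by rewrite mono_consr rmulA; case: IHq => ->; rewrite ?rmul0r; [left|right].
  by rewrite /mono /= vtxM; case: eqP => [->|_]; [left|right].
by rewrite mono_consl rmulA vtx_edg; case: eqP; rewrite ?rmul0r; [left|right].
Qed.

Lemma mono_vtx u p v q :
  mono p v q ** vtx K u = mono p v q \/ mono p v q ** vtx K u = 0.
Proof.
case: q => [|e q]; last first.
  by rewrite mono_consr -rmulA gst_vtx; case: eqP; rewrite ?rmulr0; [left|right].
elim: p => [|f p IHp]; last first.
  by rewrite mono_consl -rmulA; case: IHp => ->; rewrite ?rmulr0; [left|right].
by rewrite /mono /= vtxM; case: eqP => [->|_]; [left|right].
Qed.

Lemma gst_mono0 e v q :
  gst K e ** mono [::] v q = mono [::] (rng e) (rcons q e) \/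
  gst K e ** mono [::] v q = 0.
Proof.
elim: q => [|f q IHq]; last first.
  rewrite rcons_cons !mono_consr rmulA.
  by case: IHq => ->; rewrite ?rmul0r; [left|right].
by rewrite /mono /= gst_vtx; case: eqP; rewrite ?rng_gst; [left|right].
Qed.

Lemma mono0_edg e p v :
  mono p v [::] ** edg K e = mono (rcons p e) (rng e) [::] \/
  mono p v [::] ** edg K e = 0.
Proof.
elim: p => [|f p IHp]; last first.
  rewrite rcons_cons !mono_consl -rmulA.
  by case: IHp => ->; rewrite ?rmulr0; [left|right].
by rewrite /mono /= vtx_edg; case: eqP; rewrite ?edg_rng; [left|right].
Qed.

Lemma gst_mono_cons e f p v q :
  gst K e ** mono (f :: p) v q = mono p v q \/ gst K e ** mono (f :: p) v q = 0.
Proof.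
rewrite mono_consl rmulA gst_edg; case: eqP => _; last first.
  by rewrite rmul0r; right.
exact: vtx_mono.
Qed.

Lemma mono_cons_edg e f p v q :
  mono p v (f :: q) ** edg K e = mono p v q \/ mono p v (f :: q) ** edg K e = 0.
Proof.
rewrite mono_consr -rmulA gst_edg; case: eqP => _; last first.
  by rewrite rmulr0; right.
exact: mono_vtx.
Qed.

(** Constraining only the two lengths lets a single [P] express both a degree condition and a length
    bound. *)
Inductive mono_span (P : nat -> nat -> Prop) : L -> Prop :=
| mono_span0 : mono_span P 0
| mono_spanD k p v q x : P (size p) (size q) -> mono_span P x ->
    mono_span P (k *: mono p v q + x).

Section MonoSpan.
Variables P Q : nat -> nat -> Prop.

Lemma sub_mono_span x :
  (forall a b, P a b -> Q a b) -> mono_span P x -> mono_span Q x.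
Proof.
by move=> PQ; elim=> [|k p v q {}x /PQ ? _]; [exact: mono_span0|exact: mono_spanD].
Qed.

Lemma mono_span_mono p v q : P (size p) (size q) -> mono_span P (mono p v q).
Proof.
move=> Ppq; rewrite -[mono p v q]addr0 -[mono p v q]scale1r.
exact/mono_spanD/mono_span0.
Qed.

Lemma mono_span_add x y : mono_span P x -> mono_span P y -> mono_span P (x + y).
Proof.
move=> Px Py; elim: Px => [|k p v q {}x Ppq _]; first by rewrite add0r.
by rewrite -addrA; exact: mono_spanD.
Qed.

Lemma mono_span_scale k x : mono_span P x -> mono_span P (k *: x).
Proof.
elim=> [|l p v q {}x Ppq _]; first by rewrite scaler0; exact: mono_span0.
by rewrite scalerDr scalerA; exact: mono_spanD.
Qed.

Lemma mono_span_linear (F : L -> L) x :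
  {morph F : y z / y + z} -> (forall k, {morph F : y / k *: y}) ->
  (forall p v q, P (size p) (size q) -> mono_span Q (F (mono p v q))) ->
  mono_span P x -> mono_span Q (F x).
Proof.
move=> FD FZ FP; have F0 : F 0 = 0 by rewrite -{1}(scale0r (0 : L)) FZ scale0r.
elim=> [|k p v q {}x Ppq _ IHx]; first by rewrite F0; exact: mono_span0.
rewrite FD FZ; elim: (FP _ _ _ Ppq) => [|l p' v' q' z Qpq _ IHz].
  by rewrite scaler0 add0r.
by rewrite scalerDr scalerA -addrA; exact: mono_spanD.
Qed.

Lemma mono_span_bounded x : mono_span P x ->
  exists B, mono_span (fun a b => [/\ P a b, a <= B & b <= B]%N) x.
Proof.
elim=> [|k p v q {}x Ppq _ [B Bx]]; first by exists 0%N; exact: mono_span0.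
exists (maxn B (maxn (size p) (size q))); apply: mono_spanD.
  by rewrite !leq_max !leqnn !orbT.
elim: Bx => [|l p' v' q' z [Ppq' pB qB] _]; first exact: mono_span0.
by apply: mono_spanD; rewrite !leq_max pB qB.
Qed.

End MonoSpan.

Lemma vtx_mono_span P v x : mono_span P x -> mono_span P (vtx K v ** x).
Proof.
apply: mono_span_linear => [y z|k y|p w q Ppq]; rewrite ?rmulDr ?rscaleAr //.
by have [->|->] := vtx_mono v p w q; [exact: mono_span_mono|exact: mono_span0].
Qed.

(** Multiplication by [e^*] cancels the first edge of [p] or, when [p] is empty, lengthens [q];
    hence the two conditions linking [P] and [Q]. *)
Lemma gst_mono_span (P Q : nat -> nat -> Prop) e x :
  (forall a b, P a.+1 b -> Q a b) -> (forall b, P 0 b -> Q 0 b.+1) ->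
  mono_span P x -> mono_span Q (gst K e ** x).
Proof.
move=> PQ PQ0; apply: mono_span_linear => [y z|k y|p w q]; rewrite ?rmulDr ?rscaleAr //.
case: p => [/PQ0 Q0|f p /PQ Qpq].
  have [->|->] := gst_mono0 e w q; last exact: mono_span0.
  by apply: mono_span_mono; rewrite size_rcons.
by have [->|->] := gst_mono_cons e f p w q; [exact: mono_span_mono|exact: mono_span0].
Qed.

Lemma mono_span_edg (P Q : nat -> nat -> Prop) e x :
  (forall a b, P a b.+1 -> Q a b) -> (forall a, P a 0 -> Q a.+1 0) ->
  mono_span P x -> mono_span Q (x ** edg K e).
Proof.
move=> PQ PQ0; apply: (mono_span_linear (F := fun x => x ** edg K e)) => [y z|k y|p w q];
  rewrite ?rmulDl ?rscaleAl //.
case: q => [/PQ0 Q0|f q /PQ Qpq].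
  have [->|->] := mono0_edg e p w; last exact: mono_span0.
  by apply: mono_span_mono; rewrite size_rcons.
by have [->|->] := mono_cons_edg e f p w q; [exact: mono_span_mono|exact: mono_span0].
Qed.

Lemma mono_span_full x : mono_span (fun _ _ => True) x.
Proof.
(* The span is stable under left multiplication by each generator, hence by any [x]; applied to a
   sum of vertices that is a right unit for [x], this yields [x] itself. *)
suff mulP y : mono_span (fun _ _ => True) y -> mono_span (fun _ _ => True) (x ** y).
  have [s ->] := right_unit x; rewrite -rmul_sumr; apply: mulP.
  elim: s => [|v s IHs]; first by rewrite big_nil; exact: mono_span0.
  by rewrite big_cons; apply: mono_span_add => //; exact: (@mono_span_mono _ [::] v [::]).
elim/lpa_gen_ind: x y => [v|e|e||x IHx|x x' IHx IHx'|k x IHx|x x' IHx IHx'] y Py.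
- exact: vtx_mono_span.
- move: Py; apply: mono_span_linear => [y' z|k y'|p w q _]; rewrite ?rmulDr ?rscaleAr //.
  exact: (@mono_span_mono _ (e :: p)).
- by apply: gst_mono_span Py.
- by rewrite rmul0r; exact: mono_span0.
- by rewrite rmulNr -scaleN1r; apply: mono_span_scale; exact: IHx.
- by rewrite rmulDl; apply: mono_span_add; [exact: IHx|exact: IHx'].
- by rewrite -rscaleAl; apply: mono_span_scale; exact: IHx.
- by rewrite -rmulA; apply/IHx/IHx'.
Qed.

End LeavittBasics.

Arguments mono : simpl never.

(** * The representation attached to a hereditary saturated set *)

Section QuotientGraphRepresentation.
Variables (K : fieldType) (E : graph) (H : set (vertex E)).
Hypotheses (rfE : row_finite E) (hH : hereditary H) (sH : saturated H).

(** For [v] outside [H], these are the edges leaving [v] in the quotient graph, where [H] and the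
    edges into it are removed. *)
Definition out_edges (v : vertex E) : seq (edge E) :=
  [seq e <- fset_set (emitted v) | `[< ~ H (rng e) >]].

Lemma mem_out_edges v e : e \in out_edges v <-> src e = v /\ ~ H (rng e).
Proof.
rewrite mem_filter in_fset_set; last exact: rfE.
split=> [/andP[/asboolP nH]|[sv nH]]; first by rewrite inE.
by apply/andP; split; [exact/asboolP|rewrite inE].
Qed.

Lemma hereditary_src e : ~ H (rng e) -> ~ H (src e).
Proof.
move=> nHr Hs; apply/nHr/(hH Hs).
by exists (@Pedges E e [::] isT).
Qed.

(** Saturation enters here: a vertex outside [H] that is not a sink of [E] does not become one in
    the quotient graph, so the divisor used below is positive. *)
Lemma out_edges_neq0 v : ~ H v -> emitted v !=set0 -> (0 < size (out_edges v))%N.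
Proof.
move=> nHv v0; rewrite lt0n size_eq0; apply/eqP => out0.
apply: nHv; apply: (sH v0 (rfE v)) => _ [e ev <-]; apply: contrapT => nHe.
by have := (mem_out_edges v e).2 (conj ev nHe); rewrite out0.
Qed.

Let V : lmodType K := (vertex E * nat -> K^o)%type.

(* For [v] outside [H], division with remainder by the number [m] of edges from
   [v] to the complement of [H] identifies [nat] with [m] disjoint copies of
   itself, one for each of these edges. *)
Let a (v : vertex E) (f : V) : V :=
  fun x => if (x.1 == v) && `[< ~ H v >] then f x else 0.
Let b (e : edge E) (f : V) : V :=
  let s := out_edges (src e) in
  fun x => if [&& x.1 == src e, e \in s & x.2 %% size s == index e s]%N
           then f (rng e, x.2 %/ size s)%N else 0.
Let c (e : edge E) (f : V) : V :=
  let s := out_edges (src e) in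
  fun x => if (x.1 == rng e) && (e \in s)
           then f (src e, x.2 * size s + index e s)%N else 0.

Lemma quotient_rep_exists : exists rho, is_lpa_rep a b c rho.
Proof.
have if_lin (B : bool) (k : K) (x y : K^o) :
    (if B then k *: x + y else 0) = k *: (if B then x else 0) + (if B then y else 0).
  by case: B; rewrite // scaler0 addr0.
apply: lpa_rep_exists => [v k f g|e k f g|e k f g|v w f|e f|e f|e f|e f|e e' f|v f v0 _];
  apply/funext => -[w' n]; rewrite /a /b /c ?fctE /=.
- exact: if_lin.
- exact: if_lin.
- exact: if_lin.
- case: (v =P w) => [<-|vw] /=; first by case: ifP => // ->.
  by case: ifP => // /andP[/eqP-> _]; case: eqP.
- case: ifP => // /negP; case: ifP => //.
  move=> /and3P[/eqP-> /mem_out_edges[_ /hereditary_src nH] _].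
  by rewrite eqxx /=; case: asboolP.
- case: ifP => // /and3P[_ /mem_out_edges[_ nH] _].
  by rewrite eqxx /=; case: asboolP.
- case: ifP => // /negP; case: ifP => // /andP[/eqP-> /mem_out_edges[_ nH]].
  by rewrite eqxx /=; case: asboolP.
- case: ifP => // /andP[_ /mem_out_edges[_ /hereditary_src nH]].
  by rewrite eqxx /=; case: asboolP.
(* With [m] the size of the list, [n * m + index e] has quotient [n] and remainder [index e], which
   gives [e^* e = r(e)]; distinct edges with the same source have distinct remainders. *)
- have [<-|ee'] := eqVneq e e'.
    rewrite /a eqxx /=; have -> : e \in out_edges (src e) = `[< ~ H (rng e) >].
      apply/idP/asboolP => [/mem_out_edges[]//|nH].
      exact/mem_out_edges.
    have [->|] := eqVneq w' (rng e); last by [].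
    case: asboolP => //= nH; have eo : e \in out_edges (src e) by exact/mem_out_edges.
    have lts : (index e (out_edges (src e)) < size (out_edges (src e)))%N.
      by rewrite index_mem.
    rewrite modnMDl modn_small // eqxx divnMDl ?divn_small ?addn0 //.
    by apply: leq_ltn_trans lts.
  case: ifP => // /andP[_ eo]; case: ifP => // /and3P[/eqP ss e'o].
  rewrite -ss modnMDl modn_small ?index_mem //; rewrite -ss in e'o.
  move=> /eqP/(congr1 (nth e (out_edges (src e))))/eqP.
  by rewrite !nth_index // (negPf ee').
rewrite (_ : (\sum_(e <- _) _) (w', n) =
    \sum_(e <- fset_set (emitted v)) b e (c e f) (w', n)); last first.
  by elim/big_rec2: _ => //= e y1 y2 _ <-.
have srcv e : e \in fset_set (emitted v) -> src e = v.
  by rewrite in_fset_set ?inE //; exact: rfE.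
case: ifP => [/andP[/eqP-> /asboolP nH]|/negP nvH]; last first.
  rewrite big_seq big1 // => e /srcv sv; rewrite /b; case: ifP => // /and3P[/= /eqP wv].
  move=> /mem_out_edges[_ /hereditary_src nH] _; case: nvH.
  by rewrite wv sv eqxx /=; apply/asboolP; rewrite -sv.
have s0 := out_edges_neq0 nH v0.
(* Only the edge in position [n %% size s] contributes at the point [(v, n)]; the default value of
   [nth] is never reached. *)
set s := out_edges v in s0 *; pose e0 := nth (projT1 (cid v0)) s (n %% size s)%N.
have ltn : (n %% size s < size s)%N by rewrite ltn_mod.
have e0s : e0 \in s by rewrite mem_nth.
have [se0 nHe0] := (mem_out_edges v e0).1 e0s.
have us : uniq s by rewrite filter_uniq // fset_uniq.
have e0v : e0 \in fset_set (emitted v) by rewrite in_fset_set ?inE //; exact: rfE.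
rewrite (bigD1_seq e0) ?fset_uniq //=.
rewrite big_seq_cond big1 ?addr0 => [|e /andP[/srcv sv ne]].
  rewrite /b /c se0 -/s e0s !eqxx /= index_uniq // eqxx.
  by rewrite -divn_eq.
rewrite /b sv -/s; case: ifP => // /and3P[_ es /eqP ne0].
by move: ne; rewrite -(nth_index e0 es) -ne0 (set_nth_default (projT1 (cid v0))) ?eqxx.
Qed.

(** The kernel of the representation is an ideal containing the vertices of [H], whereas a vertex
    outside [H] acts as a nonzero projection. *)
Lemma vertices_generated_ideal v :
  generated_ideal (@vtx K E @` H) (vtx K v) <-> H v.
Proof.
split=> [gv|Hv]; last by apply: sub_generated_ideal; exists v.
apply: contrapT => nHv; have [rho [rD rM rZ rl rv _ _]] := quotient_rep_exists.
have r0 x : rho x 0 = 0 by exact/linear_map0/rl.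
pose J := [set x : lpa K E | forall f, rho x f = 0].
have JI : rng_ideal J.
  split=> [f|x y Jx Jy f|z x Jx f|z x Jx f] /=.
  - by rewrite -(scale0r (0 : lpa K E)) rZ scale0r.
  - by rewrite rD -scaleN1r rZ Jx Jy scaler0 addr0.
  - by rewrite rM Jx r0.
  - by rewrite rM Jx.
have JH : @vtx K E @` H `<=` J.
  move=> _ [w Hw <-] f; rewrite rv /a; apply/funext => x.
  by case: asboolP; rewrite ?andbF.
(* The action of [v] on the constant function 1 has value 1 at [(v, 0)]. *)
have /(congr1 (fun f => f (v, 0%N))) := gv J JI JH (fun=> 1).
rewrite rv /a eqxx /=; case: asboolP => // _ /eqP.
by rewrite oner_eq0.
Qed.

End QuotientGraphRepresentation.

(** * Components of an element of an idempotent ideal *)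

Section IdempotentIdeals.
Variables (K : fieldType) (E : graph).
Local Notation L := (lpa K E).

(** With a local unit [u] of [x], [k *: x = (k *: u) ** x], so ring ideals are closed under
    scalars. *)
Lemma ideal_scale (I : set L) k x : rng_ideal I -> I x -> I (k *: x).
Proof.
move=> II Ix; have [s ->] := left_unit x.
rewrite -rmul_suml rscaleAl; exact: rng_idealMl.
Qed.

(* Sequences [nat -> L] stand for power series in [s]: [tshift] multiplies by
   [1 + s], [tunshift] by its inverse. *)
Definition lmul_seq (x : L) (f : nat -> L) : nat -> L := fun i => x ** f i.

Definition tshift (f : nat -> L) : nat -> L :=
  fun i => f i + (if i is j.+1 then f j else 0).

Fixpoint tunshift_rec (f : nat -> L) (i : nat) : L :=
  f i - (if i is j.+1 then tunshift_rec f j else 0).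

Definition tunshift := tunshift_rec.

Lemma tunshiftS f i : tunshift f i.+1 = f i.+1 - tunshift f i.
Proof. by []. Qed.

Lemma tunshift0 f : tunshift f 0 = f 0.
Proof. by rewrite /tunshift /= subr0. Qed.

Lemma tshiftK f : tunshift (tshift f) = f.
Proof.
apply/funext; elim=> [|i IHi]; first by rewrite tunshift0 /tshift addr0.
by rewrite tunshiftS IHi /tshift addrK.
Qed.

Lemma tunshiftK f : tshift (tunshift f) = f.
Proof.
by apply/funext => -[|i]; rewrite /tshift ?tunshift0 ?addr0 // tunshiftS subrK.
Qed.

Lemma tshift_lmul x f : tshift (lmul_seq x f) = lmul_seq x (tshift f).
Proof.
by apply/funext => -[|i]; rewrite /tshift /lmul_seq rmulDr ?rmulr0.
Qed.

Lemma tunshift_lmul x f : tunshift (lmul_seq x f) = lmul_seq x (tunshift f).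
Proof.
rewrite -[lmul_seq x f in LHS](congr1 (lmul_seq x) (tunshiftK f)).
by rewrite -tshift_lmul tshiftK.
Qed.

Lemma lmul_seqM x y f : lmul_seq x (lmul_seq y f) = lmul_seq (x ** y) f.
Proof. by apply/funext => i; rewrite /lmul_seq rmulA. Qed.

Lemma lmul_seq_linear x : linear (lmul_seq x).
Proof.
by move=> k f g; apply/funext => i; rewrite /lmul_seq !fctE rmulDr rscaleAr.
Qed.

Lemma tshift_linear : linear tshift.
Proof.
move=> k f g; apply/funext => -[|i]; rewrite /tshift !fctE.
  by rewrite !addr0.
by rewrite scalerDr addrACA.
Qed.

Lemma tunshift_linear : linear tunshift.
Proof.
move=> k f g; apply: (can_inj tshiftK); rewrite tshift_linear !tunshiftK //.
Qed.

(** This is left multiplication, with [e] twisted by [1 + s] and [e^*] by its inverse. The twists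
    commute with left multiplication and cancel in [e^* f] and [e e^*], so the Leavitt relations
    survive. *)
Lemma gauge_rep_exists : exists rho : L -> (nat -> L) -> (nat -> L),
  is_lpa_rep (fun v => lmul_seq (vtx K v))
    (fun e f => tshift (lmul_seq (edg K e) f))
    (fun e f => tunshift (lmul_seq (gst K e) f)) rho.
Proof.
have lm0 f : lmul_seq 0 f = 0 by apply/funext => i; rewrite /lmul_seq rmul0r.
apply: lpa_rep_exists => [v|e|e|v w f|e f|e f|e f|e f|e e' f|v f v0 vfin].
- exact: lmul_seq_linear.
- by move=> k f g; rewrite lmul_seq_linear tshift_linear.
- by move=> k f g; rewrite lmul_seq_linear tunshift_linear.
- by rewrite lmul_seqM vtxM; case: eqP.
- by rewrite -tshift_lmul lmul_seqM src_edg.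
- by rewrite lmul_seqM edg_rng.
- by rewrite -tunshift_lmul lmul_seqM rng_gst.
- by rewrite lmul_seqM gst_src.
- by rewrite -tshift_lmul tshiftK lmul_seqM gst_edg; case: eqP.
rewrite (vtx_sum K v0 vfin) (_ : lmul_seq _ f =
    \sum_(e <- fset_set (emitted v)) lmul_seq (edg K e ** gst K e) f).
  by apply: eq_bigr => e _; rewrite -tunshift_lmul tunshiftK lmul_seqM.
by apply/funext => i; rewrite fct_sumE /lmul_seq rmul_suml.
Qed.

Section GaugeRepresentation.
Variable rho : L -> (nat -> L) -> (nat -> L).
Hypothesis rhoP : is_lpa_rep (fun v => lmul_seq (vtx K v))
    (fun e f => tshift (lmul_seq (edg K e) f))
    (fun e f => tunshift (lmul_seq (gst K e) f)) rho.

Lemma iter_tshift_lmul n x f :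
  iter n tshift (lmul_seq x f) = lmul_seq x (iter n tshift f).
Proof. by elim: n => //= n ->; rewrite tshift_lmul. Qed.

(** A monomial acts as left multiplication times [(1 + s)^(|p| - |q|)]; the power [|q|] is moved to
    the other side to avoid negative exponents. *)
Lemma gauge_mono p v q f :
  iter (size q) tshift (rho (mono K p v q) f) =
  iter (size p) tshift (lmul_seq (mono K p v q) f).
Proof.
elim: p f => [|e p IHp] f.
  elim: q f => [|e q IHq] f; first by rewrite (rep_vtx rhoP).
  rewrite mono_consr (repM rhoP) (rep_gst rhoP) iterS IHq /=.
  by rewrite tshift_lmul tunshiftK lmul_seqM.
rewrite mono_consl (repM rhoP) (rep_edg rhoP) -iterSr iterS iter_tshift_lmul IHp.
by rewrite -iter_tshift_lmul lmul_seqM.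
Qed.

Section IdealInvariance.
Variable I : set L.
Hypothesis II : rng_ideal I.
Let sI := rng_ideal_subgroup II.

(* [rho x] is triangular with respect to the order of power series, with [x] on
   the diagonal. *)
Lemma gauge_triangular x n f : (forall i, (i < n)%N -> I (f i)) ->
  (forall i, (i < n)%N -> I (rho x f i)) /\ I (rho x f n - x ** f n).
Proof.
elim/lpa_gen_ind: x f => [v|e|e||x IHx|x y IHx IHy|k x IHx|x y IHx IHy] f If.
- rewrite (rep_vtx rhoP); split=> [i /If|]; first exact: rng_idealMl.
  by rewrite /lmul_seq subrr; exact: (subgroup0 sI).
- have Ief i : (i < n)%N -> I (lmul_seq (edg K e) f i).
    by move=> /If; exact: rng_idealMl.
  rewrite (rep_edg rhoP) /tshift; split=> [[|i] ilt|].
  + by rewrite addr0; exact: Ief.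
  + by apply: (subgroupD sI); apply: Ief => //; exact: ltnW.
  + rewrite addrC addKr; case: n Ief {If} => [|n] Ief; first exact: (subgroup0 sI).
    exact: Ief.
- have Igf i : (i < n)%N -> I (tunshift (lmul_seq (gst K e) f) i).
    elim: i => [|i IHi] ilt.
      by rewrite tunshift0; apply: rng_idealMl => //; exact: If.
    rewrite tunshiftS; apply: (subgroupB sI); last exact/IHi/ltnW.
    by apply: rng_idealMl => //; exact: If.
  rewrite (rep_gst rhoP); split=> //.
  case: n Igf {If} => [|n] Igf.
    by rewrite tunshift0 subrr; exact: (subgroup0 sI).
  by rewrite tunshiftS addrAC subrr sub0r; apply: (subgroupN sI); exact: Igf.
- have rho0 : rho 0 f = 0 by rewrite -(scale0r (0 : L)) (repZ rhoP) scale0r.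
  by rewrite rho0 rmul0r subrr; split=> *; exact: (subgroup0 sI).
- have rhoN : rho (- x) f = - rho x f by rewrite -scaleN1r (repZ rhoP) scaleN1r.
  have [Ix Jx] := IHx f If; rewrite rhoN rmulNr; split=> [i /Ix|].
    exact: (subgroupN sI).
  by rewrite -opprD; exact: (subgroupN sI).
- have [Ix Jx] := IHx f If; have [Iy Jy] := IHy f If.
  rewrite (repD rhoP) rmulDl; split=> [i ilt|].
    by apply: (subgroupD sI); [exact: Ix|exact: Iy].
  by rewrite opprD !fctE addrACA; exact: (subgroupD sI).
- have [Ix Jx] := IHx f If; rewrite (repZ rhoP) -rscaleAl; split=> [i /Ix|].
    exact: ideal_scale.
  by rewrite !fctE -scalerBr; exact: ideal_scale.
- have [Iy Jy] := IHy f If; have [Ix Jx] := IHx _ Iy.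
  rewrite (repM rhoP); split=> //.
  rewrite -[_ - _](subrKA (x ** rho y f n)); apply: (subgroupD sI) => //.
  by rewrite -rmulA -rmulrB; exact: rng_idealMl.
Qed.

(** For [z] and [y] in [I], once the coefficients of [rho y g] below [i] lie in [I],
    [gauge_triangular] makes coefficient [i] of [rho z (rho y g)] congruent to [z ** rho y g i],
    which is in [I]. Each use of idempotency thus gains one coefficient. *)
Lemma gauge_idempotent_ideal x f n : idempotent_ideal I -> I x -> I (rho x f n).
Proof.
case=> _ Isq; suff H m z g i : I z -> (i < m)%N -> I (rho z g i) by move=> /H; exact.
elim: m z g i => // m IHm z g i Iz; rewrite ltnS => im; move: z Iz g.
(* The test subgroup is the set of [z] with [rho z g i] in [I] for all [g]. *)
apply: Isq => [|z y Iz Iy g].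
  split=> [g|z y Iz Iy g]; rewrite /=.
    by rewrite -(scale0r (0 : L)) (repZ rhoP) scale0r; exact: (subgroup0 sI).
  by rewrite (repD rhoP) -scaleN1r (repZ rhoP) scaleN1r; exact: (subgroupB sI).
rewrite (repM rhoP); have [j ji|_ ] := @gauge_triangular z i (rho y g).
  by apply: IHm => //; exact: leq_trans im.
by move/(subgroupD sI)/(_ (rng_idealMr (rho y g i) II Iz)); rewrite subrK.
Qed.

End IdealInvariance.

End GaugeRepresentation.

(** Degrees are shifted by a bound [B] on the lengths: the index [d] stands for the degree
    [d - B]. *)
Lemma mono_decomposition (x : L) : exists B N (y : nat -> L),
  x = \sum_(d < N) y d /\
  forall d, mono_span (fun a b => b <= B /\ a + B = d + b)%N (y d).
Proof.
have [B Bx] := mono_span_bounded (mono_span_full x).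
(* The degrees run from [-B] to [B]. *)
exists B, (B + B).+1; elim: Bx => [|k p v q {}x [_ pB qB] _ [y [-> yP]]].
  exists (fun=> 0); split=> [|d]; last exact: mono_span0.
  by rewrite big1.
have dlt : (size p + B - size q < (B + B).+1)%N.
  by rewrite ltnS (leq_trans (leq_subr _ _)) // leq_add2r.
exists (fun d => (if d == (size p + B - size q)%N then k *: mono K p v q else 0) + y d).
split=> [|d].
  rewrite big_split /=; congr (_ + _).
  by rewrite -big_mkcond /= (big_pred1 (Ordinal dlt)).
apply: mono_span_add => //; case: eqP => [->|_]; last exact: mono_span0.
apply/mono_span_scale/mono_span_mono; split=> //.
by rewrite subnK // (leq_trans qB) // leq_addl.
Qed.

Lemma iter_tshift_delta d x k :
  iter d tshift (fun i => if i == 0%N then x else 0) k = x *+ 'C(d, k).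
Proof.
elim: d k => [|d IHd] [|k] //=; rewrite /tshift !IHd ?bin0 ?addr0 //.
by rewrite binS mulrnDr.
Qed.

(** Multiplying by [(1 + s)^B] clears the negative exponents, and evaluating at a common right unit
    of the [y d] gives the series [sum_d (1 + s)^d y_d], whose coefficients lie in [I]. *)
Lemma idempotent_ideal_components (I : set L) x : idempotent_ideal I -> I x ->
  exists B N (y : nat -> L), [/\ x = \sum_(d < N) y d,
    forall d, mono_span (fun a b => a + B = d + b)%N (y d) &
    forall d, (d < N)%N -> I (y d)].
Proof.
move=> idI Ix; have II := idI.1; have sI := rng_ideal_subgroup II.
have [B [N [y [xE yP]]]] := mono_decomposition x.
exists B, N, y; split=> // [d|]; first by apply: sub_mono_span (yP d) => a b [].
have [rho rhoP] := gauge_rep_exists.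
have [u yu] := common_right_unit N y.
pose del z : nat -> L := fun i => if i == 0%N then z else 0.
have lin_iter n : linear (iter n tshift).
  by elim: n => // n IHn k f g; rewrite !iterS IHn tshift_linear.
have yT d f : iter B tshift (rho (y d) f) = iter d tshift (lmul_seq (y d) f).
  elim: (yP d) => [|k p v q z [qB pqd] _ IHz].
    rewrite -(scale0r (0 : L)) (repZ rhoP) scale0r (linear_map0 (lin_iter B)).
    rewrite scale0r (_ : lmul_seq _ _ = 0) ?(linear_map0 (lin_iter d)) //.
    by apply/funext => i; rewrite /lmul_seq rmul0r.
  rewrite (repD rhoP) (repZ rhoP) lin_iter IHz.
  rewrite -{1}(subnK qB) iterD (gauge_mono rhoP) -iterD.
  have -> : (B - size q + size p = d)%N.
    by apply/(@addIn (size q)); rewrite -pqd addnAC subnK // addnC.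
  rewrite -lin_iter; congr iter; apply/funext => i.
  by rewrite /lmul_seq !fctE rmulDl rscaleAl.
have binI k : I (\sum_(d < N) y d *+ 'C(d, k)).
  rewrite (_ : \sum_(d < N) _ = iter B tshift (rho x (del u)) k).
    (* Multiplication by [1 + s] keeps all coefficients in [I]. *)
    elim: B k {yP yT xE} => [|B IHB] k.
      exact: (gauge_idempotent_ideal rhoP II _ _ idI Ix).
    rewrite iterS /tshift; apply: (subgroupD sI); first exact: IHB.
    by case: k => [|k]; [exact: (subgroup0 sI)|exact: IHB].
  have -> : rho x (del u) = \sum_(d < N) rho (y d) (del u).
    rewrite xE; elim/big_rec2: _ => [|d z1 z2 _ <-]; last by rewrite (repD rhoP).
    by rewrite -(scale0r (0 : L)) (repZ rhoP) scale0r.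
  have -> : iter B tshift (\sum_(d < N) rho (y d) (del u)) =
      \sum_(d < N) iter B tshift (rho (y d) (del u)).
    elim/big_rec2: _ => [|d z1 z2 _ <-]; first exact/linear_map0/lin_iter.
    by have := lin_iter B 1 (rho (y d) (del u)) z2; rewrite !scale1r.
  rewrite fct_sumE; apply: eq_bigr => d _; rewrite yT -(iter_tshift_delta d (y d)).
  congr (iter _ _ _ _); apply/funext => i; rewrite /lmul_seq /del.
  by case: eqP; rewrite ?rmulr0 ?yu.
(* Descending induction on [d]: for [d' < d] the binomial coefficient vanishes, and for [d' > d] the
   component is already in [I]. *)
move=> d dN; have [m] := ubnP (N - d); elim: m d dN => // m IHm d dN.
rewrite ltnS => Ndm.
have -> : y d = \sum_(d' < N) y d' *+ 'C(d', d) -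
    \sum_(d' < N | d' != Ordinal dN) y d' *+ 'C(d', d).
  by rewrite (bigD1 (Ordinal dN)) //= binn addrK.
apply: (subgroupB sI) => //; apply: (subgroup_sum sI) => d' /eqP d'd.
have [d'lt|d'ge] := ltnP d' d; first by rewrite bin_small //; exact: (subgroup0 sI).
apply: (subgroupMn sI); apply: IHm => //; apply: leq_trans Ndm.
apply: ltn_sub2l => //; rewrite ltn_neqAle d'ge andbT.
by apply/eqP => dd'; apply/d'd/val_inj.
Qed.

End IdempotentIdeals.

(** * Graded ideals *)

Section Homogeneous.
Variables (K : fieldType) (E : graph).
Local Notation L := (lpa K E).
Implicit Types (P Q : gpath E) (e f : edge E) (x y z : L).

Lemma foldl_edgM y z es :
  foldl (fun x f => x ** edg K f) (y ** z) es =
  y ** foldl (fun x f => x ** edg K f) z es.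
Proof. by elim: es z => //= f es IHes z; rewrite -rmulA IHes. Qed.

Lemma foldl_gstM y z es :
  foldl (fun x f => gst K f ** x) (z ** y) es =
  foldl (fun x f => gst K f ** x) z es ** y.
Proof. by elim: es z => //= f es IHes z; rewrite rmulA IHes. Qed.

Lemma gpath_mono P : exists p, [/\ size p = plength P,
  lpa_path K P = mono K p (prng P) [::] & lpa_path_star K P = mono K [::] (prng P) p].
Proof.
case: P => [v|e es]; first by exists [::].
elim: es e => [|f es IHes] e /= => [_|/andP[/eqP ef fes]].
  by exists [:: e]; rewrite mono_consl mono_consr edg_rng rng_gst.
have [p [sp pP pQ]] := IHes f fes; exists (e :: p); split=> /=.
- by rewrite sp.
- by rewrite foldl_edgM mono_consl -pP.
- by rewrite foldl_gstM mono_consr -pQ.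
Qed.

Lemma gpath_cons e P : rng e = psrc P -> exists Q, [/\ plength Q = (plength P).+1,
  lpa_path K Q = edg K e ** lpa_path K P &
  lpa_path_star K Q = lpa_path_star K P ** gst K e].
Proof.
case: P => [v ev|f es fes ef].
  by exists (@Pedges E e [::] isT); rewrite /= -[v]ev edg_rng rng_gst.
have ees : path (fun f g => rng f == src g) e (f :: es).
  by rewrite /= fes andbT; apply/eqP.
by exists (Pedges ees); rewrite /= foldl_edgM foldl_gstM.
Qed.

Lemma psrc_lpa_path P : vtx K (psrc P) ** lpa_path K P = lpa_path K P.
Proof.
case: P => [v|e es _] /=; first by rewrite vtxM eqxx.
by rewrite -foldl_edgM src_edg.
Qed.

Lemma lpa_path_star_psrc P : lpa_path_star K P ** vtx K (psrc P) = lpa_path_star K P.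
Proof.
case: P => [v|e es _] /=; first by rewrite vtxM eqxx.
by rewrite -foldl_gstM gst_src.
Qed.

(** Edges are added one at a time; an edge that does not end at the source of the path built so far
    makes the product vanish. *)
Lemma mono_gpath (p q : seq (edge E)) v : mono K p v q = 0 \/
  exists P Q, [/\ plength P = size p, plength Q = size q &
    mono K p v q = lpa_path K P ** lpa_path_star K Q].
Proof.
elim: p => [|e p [IHp|[P [Q [sP sQ IHp]]]]].
- elim: q => [|e q [IHq|[P [Q [sP sQ IHq]]]]].
  + by right; exists (Pvertex v), (Pvertex v); rewrite /mono /= vtxM eqxx.
  + by left; rewrite mono_consr IHq rmul0r.
  + rewrite mono_consr IHq -rmulA; have [eQ|neQ] := eqVneq (rng e) (psrc Q).
      have [Q' [sQ' _ Q'E]] := gpath_cons eQ.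
      by right; exists P, Q'; rewrite sQ' sQ Q'E.
    left; rewrite -lpa_path_star_psrc -rmulA vtx_gst eq_sym (negPf neQ).
    by rewrite !rmulr0.
- by left; rewrite mono_consl IHp rmulr0.
- rewrite mono_consl IHp rmulA; have [eP|neP] := eqVneq (rng e) (psrc P).
    have [P' [sP' P'E _]] := gpath_cons eP.
    by right; exists P', Q; rewrite sP' sP P'E.
  left; rewrite -psrc_lpa_path !rmulA edg_vtx (negPf neP).
  by rewrite !rmul0r.
Qed.

Lemma monoM (p q : seq (edge E)) v w :
  mono K p v [::] ** mono K [::] w q = if v == w then mono K p v q else 0.
Proof.
elim: p => [|e p IHp]; last first.
  by rewrite !mono_consl -rmulA IHp; case: eqP => _; rewrite ?rmulr0.
elim: q => [|e q IHq]; first by rewrite /mono /= vtxM.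
by rewrite !mono_consr rmulA IHq; case: eqP => _; rewrite ?rmul0r.
Qed.

(** [lpa_homogeneous] allows two paths with different ranges; such products vanish by [monoM]. *)
Lemma homogeneousP n x :
  lpa_homogeneous n x <-> mono_span (fun a b => a%:Z - b%:Z = n) x.
Proof.
split=> [[m [c [P [Q [PQ ->]]]]]|].
  elim/big_ind: _ => [|y z|i _]; [exact: mono_span0|exact: mono_span_add|].
  apply: mono_span_scale; have [p [sp -> _]] := gpath_mono (P i).
  have [q [sq _ ->]] := gpath_mono (Q i); rewrite monoM.
  case: eqP => _; last exact: mono_span0.
  by apply: mono_span_mono; rewrite sp sq PQ.
elim=> [|k p v q {}x pq _ [m [c [P [Q [PQ ->]]]]]].
  pose empty (i : 'I_0) : gpath E := False_rect _ (notF (ltn_ord i)).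
  by exists 0%N, (fun=> 0), empty, empty; split=> [[]|]//; rewrite big_ord0.
have [->|[P0 [Q0 [sP sQ ->]]]] := mono_gpath p q v.
  by rewrite scaler0 add0r; exists m, c, P, Q.
exists m.+1, (fun i => oapp c k (unlift ord0 i)), (fun i => oapp P P0 (unlift ord0 i)),
  (fun i => oapp Q Q0 (unlift ord0 i)); split=> [i|].
  by case: unliftP => [j|] _ //=; rewrite sP sQ.
rewrite big_ord_recl unlift_none; congr (_ + _).
by apply: eq_bigr => i _; rewrite !liftK.
Qed.

Lemma idempotent_ideal_graded (I : set L) : idempotent_ideal I -> graded_ideal I.
Proof.
move=> idI; split=> [|x Ix]; first by case: idI.
have [B [N [y [-> yB yI]]]] := idempotent_ideal_components idI Ix.
(* This undoes the shift by [B]; on the degrees listed, [n + B] is nonnegative and the absolute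
   value merely recovers [d]. *)
exists [seq d%:Z - B%:Z | d <- iota 0 N], (fun n => y `|(n + B%:Z)%R|%N); split.
- rewrite map_inj_uniq ?iota_uniq // => d d' /addIr; by case.
- move=> n /mapP[d + ->]; rewrite mem_iota /= add0n => dN; rewrite subrK.
  split; first exact: yI.
  apply/homogeneousP; apply: sub_mono_span (yB d) => a b abd.
  by apply/eqP; rewrite subr_eq addrAC eq_sym subr_eq -!PoszD abd.
- rewrite big_map -[in RHS](subn0 N) -/(index_iota _ _) big_mkord.
  by apply: eq_bigr => d _; rewrite subrK.
Qed.

End Homogeneous.

(** * Graded ideals are generated by their vertices *)

Section GradedIdeals.
Variables (K : fieldType) (E : graph).
Hypothesis rfE : row_finite E.
Local Notation L := (lpa K E).
Implicit Types (I J : set L) (v w : vertex E) (x : L).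

Definition ideal_vertices I : set (vertex E) := [set v | I (vtx K v)].

(** Along a single edge, [r(e) = e^* s(e) e]. *)
Lemma ideal_vertices_hereditary I : rng_ideal I -> hereditary (ideal_vertices I).
Proof.
move=> II v w Iv [P [sP rP]].
suff step e : I (vtx K (src e)) -> I (vtx K (rng e)).
  case: P sP rP => [u /= -> <- //|e es ees /= ev <-]; rewrite -ev in Iv.
  elim: es e {ev} Iv ees => [|f es IHes] e /step //= Ie /andP[/eqP ef].
  by apply: IHes; rewrite -ef.
have -> : vtx K (rng e) = gst K e ** vtx K (src e) ** edg K e.
  by rewrite gst_src gst_edg eqxx.
by move=> Is; apply/(rng_idealMr _ II)/(rng_idealMl _ II).
Qed.

(** Each summand in the expansion of [v] is [e r(e) e^*]. *)
Lemma ideal_vertices_saturated I : rng_ideal I -> saturated (ideal_vertices I).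
Proof.
move=> II v v0 vfin sub; rewrite /ideal_vertices /= (vtx_sum K v0 vfin).
apply: (subgroup_sum_seq (rng_ideal_subgroup II)) => e.
rewrite in_fset_set // inE => ev; rewrite -edg_rng -rmulA.
apply/(rng_idealMl _ II)/(rng_idealMr _ II).
by apply: sub; exists e.
Qed.

Section VerticesGenerate.
Variables I J : set L.
Hypotheses (II : rng_ideal I) (JI : rng_ideal J).
Hypothesis IJ : ideal_vertices I `<=` ideal_vertices J.
Let sJ := rng_ideal_subgroup JI.

Lemma ideal_local_left x : (forall v, J (vtx K v ** x)) -> J x.
Proof.
by move=> Jv; have [s ->] := left_unit x; apply: (subgroup_sum sJ).
Qed.

Lemma ideal_local_right x : (forall v, J (x ** vtx K v)) -> J x.
Proof.
by move=> Jv; have [s ->] := right_unit x; apply: (subgroup_sum sJ).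
Qed.

(** Expanding [v] trades [x] for the elements [e^* x], of degree one less when [x] is
    homogeneous. *)
Lemma ideal_emit_left v x : emitted v !=set0 ->
  (forall e, J (gst K e ** x)) -> J (vtx K v ** x).
Proof.
move=> v0 Je; rewrite (vtx_sum K v0 (rfE v)) rmul_suml.
by apply: (subgroup_sum sJ) => e _; rewrite -rmulA; exact: rng_idealMl.
Qed.

Lemma ideal_emit_right v x : emitted v !=set0 ->
  (forall e, J (x ** edg K e)) -> J (x ** vtx K v).
Proof.
move=> v0 Je; rewrite (vtx_sum K v0 (rfE v)) rmul_sumr.
by apply: (subgroup_sum sJ) => e _; rewrite rmulA; exact: rng_idealMr.
Qed.

Lemma sink_edg v e : ~ (emitted v !=set0) -> vtx K v ** edg K e = 0.
Proof.
by move=> v0; rewrite vtx_edg; case: eqP => // ve; case: v0; exists e.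
Qed.

Lemma gst_sink v e : ~ (emitted v !=set0) -> gst K e ** vtx K v = 0.
Proof.
by move=> v0; rewrite gst_vtx; case: eqP => // ve; case: v0; exists e.
Qed.

(** A monomial of degree 0 other than a vertex starts with an edge and ends with a ghost edge, so
    the corner kills it when [v] or [w] is a sink; for [N = 0] there is none. *)
Lemma corner_scalar v w N x :
  [\/ N = 0%N, ~ (emitted v !=set0) | ~ (emitted w !=set0)] ->
  mono_span (fun a b => a = b /\ (a <= N)%N) x ->
  exists c, vtx K v ** x ** vtx K w = c *: vtx K v.
Proof.
move=> trivial_corner; elim=> [|k p u q {}x [spq pN] _ [c xc]].
  by exists 0; rewrite rmulr0 rmul0r scale0r.
suff [d pqd] : exists d, vtx K v ** mono K p u q ** vtx K w = d *: vtx K v.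
  exists (k * d + c); rewrite rmulDr rmulDl xc -rscaleAr -rscaleAl pqd scalerA.
  by rewrite -scalerDl.
case: p q spq pN => [|e p] [|f q] //= spq pN.
  rewrite /mono /= vtxM; case: eqP => _; last by exists 0; rewrite rmul0r scale0r.
  by rewrite vtxM; case: eqP => _; [exists 1; rewrite scale1r|exists 0; rewrite scale0r].
exists 0; rewrite scale0r; case: trivial_corner => [N0|v0|w0].
- by rewrite N0 in pN.
- by rewrite mono_consl rmulA sink_edg // !rmul0r.
- by rewrite mono_consr -!rmulA gst_sink // !rmulr0.
Qed.

(** If the corner is [c *: v] with [c] nonzero, dividing by [c] puts [v] in [I], hence in [J]. *)
Lemma corner_sub v w N x :
  [\/ N = 0%N, ~ (emitted v !=set0) | ~ (emitted w !=set0)] ->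
  I x -> mono_span (fun a b => a = b /\ (a <= N)%N) x ->
  J (vtx K v ** x ** vtx K w).
Proof.
move=> trivial_corner Ix /(corner_scalar trivial_corner)[c vxw].
have Ivxw : I (vtx K v ** x ** vtx K w) by exact/(rng_idealMr _ II)/(rng_idealMl _ II).
rewrite vxw in Ivxw *.
have [->|c0] := eqVneq c 0; first by rewrite scale0r; exact: (subgroup0 sJ).
apply: ideal_scale => //; apply: IJ.
have := ideal_scale (c^-1) II Ivxw.
by rewrite scalerA mulVf // scale1r.
Qed.

(** Induction on the length bound: when neither [v] nor [w] is a sink, [v x w] is a sum of elements
    [e (e^* x f) f^*], and the bound for [e^* x f] is one less. *)
Lemma degree0_sub N x : I x -> mono_span (fun a b => a = b /\ (a <= N)%N) x -> J x.
Proof.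
elim: N x => [|N IHN] x Ix xN; apply: ideal_local_left => v;
  apply: ideal_local_right => w.
  by apply: (corner_sub _ Ix xN); exact: Or31.
have [v0|v0] := pselect (emitted v !=set0); last first.
  by apply: (corner_sub _ Ix xN); exact: Or32.
have [w0|w0] := pselect (emitted w !=set0); last first.
  by apply: (corner_sub _ Ix xN); exact: Or33.
rewrite -rmulA; apply: ideal_emit_left => // e; rewrite rmulA.
apply: ideal_emit_right => // f; apply: IHN.
  exact/(rng_idealMr _ II)/(rng_idealMl _ II).
(* [P] describes the intermediate element [e^* x], of degree -1. *)
pose P a b := b = a.+1 /\ (a <= N)%N.
have : mono_span P (gst K e ** x) by apply: gst_mono_span xN => [a b [<-]|b [<-]].
by apply: mono_span_edg => [a b [[->]]|a []].
Qed.

(** Multiplication by [e^*] lowers the degree, down to [degree0_sub]; at a sink [v], [v x = 0]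
    because monomials of positive degree start with an edge. *)
Lemma positive_degree_sub n x :
  I x -> mono_span (fun a b => a = b + n)%N x -> J x.
Proof.
elim: n x => [|n IHn] x Ix xn.
  have [B xB] := mono_span_bounded xn; apply: (degree0_sub Ix (N := B)).
  by apply: sub_mono_span xB => a b [-> aB _]; rewrite addn0 in aB *.
apply: ideal_local_left => v.
have [v0|v0] := pselect (emitted v !=set0).
  apply: ideal_emit_left => // e; apply: IHn; first exact: rng_idealMl.
  by apply: gst_mono_span xn => [a b|b]; rewrite addnS => // -[].
suff -> : vtx K v ** x = 0 by exact: (subgroup0 sJ).
elim: xn {Ix} => [|k p u q {}x pq _ IHx]; first by rewrite rmulr0.
rewrite rmulDr IHx addr0 -rscaleAr; case: p pq => [|e p _]; first by rewrite addnS.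
by rewrite mono_consl rmulA sink_edg // rmul0r scaler0.
Qed.

Lemma negative_degree_sub n x :
  I x -> mono_span (fun a b => b = a + n)%N x -> J x.
Proof.
elim: n x => [|n IHn] x Ix xn.
  apply: (positive_degree_sub Ix (n := 0)).
  by apply: sub_mono_span xn => a b ->; rewrite !addn0.
apply: ideal_local_right => v.
have [v0|v0] := pselect (emitted v !=set0).
  apply: ideal_emit_right => // e; apply: IHn; first exact: rng_idealMr.
  by apply: mono_span_edg xn => [a b|a]; rewrite addnS => // -[].
suff -> : x ** vtx K v = 0 by exact: (subgroup0 sJ).
elim: xn {Ix} => [|k p u q {}x pq _ IHx]; first by rewrite rmul0r.
rewrite rmulDl IHx addr0 -rscaleAl; case: q pq => [|e q _]; first by rewrite addnS.
by rewrite mono_consr -rmulA gst_sink // rmulr0 scaler0.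
Qed.

End VerticesGenerate.

(** The homogeneous components of an element of [I] lie in [I], and the degree lemmas move each of
    them into the ideal generated by the vertices. *)
Lemma graded_ideal_generated I : graded_ideal I ->
  I = generated_ideal (@vtx K E @` ideal_vertices I).
Proof.
move=> [II gI]; apply/seteqP; split; last first.
  by apply: generated_ideal_min => // _ [v Iv <-].
set G := generated_ideal _; have GI : rng_ideal G := generated_ideal_ideal _.
move=> x /gI[s [y [_ yI ->]]]; apply: (subgroup_sum_seq (rng_ideal_subgroup GI)) => n.
have IG : ideal_vertices I `<=` ideal_vertices G.
  by move=> v Iv; apply: sub_generated_ideal; exists v.
move=> /yI[Iy /homogeneousP yn]; case: n yn Iy => n yn Iy.
  apply: (positive_degree_sub II GI IG Iy (n := n)).
  apply: sub_mono_span yn => a b /eqP; rewrite subr_eq -PoszD => /eqP[->].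
  by rewrite addnC.
(* [Negz n] stands for [-(n + 1)]. *)
apply: (negative_degree_sub II GI IG Iy (n := n.+1)).
apply: sub_mono_span yn => a b /eqP.
by rewrite NegzE subr_eq eq_sym addrC subr_eq -PoszD => /eqP[].
Qed.

Lemma idempotent_vertices_ideal (H : set (vertex E)) :
  idempotent_ideal (generated_ideal (@vtx K E @` H)).
Proof.
by apply: generated_by_idempotents => _ [v _ <-]; rewrite vtxM eqxx.
Qed.

Lemma graded_idempotentP I : graded_ideal I <-> idempotent_ideal I.
Proof.
split=> [/graded_ideal_generated->|]; first exact: idempotent_vertices_ideal.
exact: idempotent_ideal_graded.
Qed.

End GradedIdeals.

(** * The bijection between hereditary saturated sets *)

Lemma idempotent_ideal_vertices_bij (K : fieldType) (E F : graph)
    (rfE : row_finite E) (rfF : row_finite F)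
    (phi : lpa K E -> lpa K F) (hphi : rng_isomorphism phi) :
  set_bij (hereditary_saturated_sets E) (hereditary_saturated_sets F)
    (fun H => ideal_vertices (phi @` generated_ideal (@vtx K E @` H))).
Proof.
have [_ _ [psi phiK psiK]] := hphi; have hpsi := rng_iso_inv hphi phiK psiK.
(* With [graded_ideal_generated], this makes hereditary saturated sets correspond to idempotent
   ideals. *)
have verticesK (G : graph) (H : set (vertex G)) : row_finite G ->
    hereditary_saturated_sets G H ->
    ideal_vertices (generated_ideal (@vtx K G @` H)) = H.
  by move=> rfG [hH sH]; apply/seteqP; split=> v;
    rewrite /ideal_vertices /= vertices_generated_ideal.
have image_idem H : idempotent_ideal (phi @` generated_ideal (@vtx K E @` H)).
  exact/(idempotent_ideal_image hphi)/idempotent_vertices_ideal.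
split=> [H _|H H' /set_mem HE /set_mem HE' eqHH'|G GF].
- have [II _] := image_idem H.
  by split; [exact: ideal_vertices_hereditary|exact: ideal_vertices_saturated].
(* Injectivity: both image ideals are graded, hence determined by their vertices; [psi] carries
   their equality back to the ideals generated by [H] and [H']. *)
- have /(graded_ideal_generated rfF) := (graded_idempotentP rfF _).2 (image_idem H).
  rewrite eqHH' -(graded_ideal_generated rfF) => [eqI|]; last first.
    exact/(graded_idempotentP rfF)/image_idem.
  rewrite -(verticesK _ _ rfE HE) -(verticesK _ _ rfE HE'); congr ideal_vertices.
  have := congr1 (fun A => psi @` A) eqI.
  by rewrite !image_comp (_ : psi \o phi = id) ?image_id //; exact/funext.
(* Surjectivity: the preimage of [G] is the vertex set of the ideal that [psi] carries back from the
   one generated by [G]. *)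
- pose I := psi @` generated_ideal (@vtx K F @` G).
  have idI : idempotent_ideal I.
    exact/(idempotent_ideal_image hpsi)/idempotent_vertices_ideal.
  exists (ideal_vertices I).
    have II := idI.1.
    by split; [exact: ideal_vertices_hereditary|exact: ideal_vertices_saturated].
  rewrite -(graded_ideal_generated rfE); last exact/(graded_idempotentP rfE).
  rewrite image_comp (_ : phi \o psi = id); last exact/funext.
  by rewrite image_id verticesK.
Qed.

Theorem proposition3p4 (K : fieldType) (E F : graph)
    (hE : row_finite E) (hF : row_finite F)
    (phi : lpa K E -> lpa K F) (hphi : rng_isomorphism phi) :
  (forall I : set (lpa K E), graded_ideal I -> graded_ideal (phi @` I)) /\
  hereditary_saturated_sets E #= hereditary_saturated_sets F.
Proof.
split=> [I /(graded_idempotentP hE) idI|].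
  exact/(graded_idempotentP hF)/(idempotent_ideal_image hphi).
apply/card_set_bijP; eexists.
exact: (idempotent_ideal_vertices_bij hE hF hphi).
Qed.
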